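(* There exists a Strong PIP algorithm to construct the 2D convex hull of $n$ unsorted points in the plane.
   Context: Strong PIP (parallel in-place): a parallel algorithm with a shared memory and private memory for each processor (measured in words) is Strong PIP, for input size $n$, if it (1) allocates no shared memory aside from the input, (2) uses $O(\log n)$ private memory per processor, (3) has polylogarithmic span, i.e. $O(\mathrm{polylog}(n))$, and (4) uses at most $O(\log n)$ additional space when run sequentially. Span is the maximum number of operations performed by a single processor when the number of processors is not bounded. The input is an array of $n$ points in the plane, in arbitrary order, in shared memory (each point occupying $O(1)$ words, with geometric primitives such as orientation tests and slope comparisons taking constant time). The points are in general position and no two share the same $x$-coordinate. Constructing the convex hull means computing the upper hull (the lower hull being computed symmetrically): the array is permuted so that, where $h$ is the number of upper-hull points, its first $h$ entries are the upper-hull points in order of $x$-coordinate, the remaining points being in arbitrary order, and $h$ is known to a processor. *)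

(* Defs.v *)
From mathcomp Require Import all_boot all_order all_algebra.

Set Implicit Arguments.
Unset Strict Implicit.
Unset Printing Implicit Defensive.

Import Order.TTheory GRing.Theory Num.Theory.

(** * Planar geometry *)

Section Geometry.
Variable R : realFieldType.
Local Open Scope ring_scope.

Definition point : Type := (R * R)%type.

(* Twice the signed area of the triangle p q r: positive iff p, q, r make a
   left (counterclockwise) turn. *)
Definition orient (p q r : point) : R :=
  (q.1 - p.1) * (r.2 - p.2) - (q.2 - p.2) * (r.1 - p.1).

(* Slope of the line p q; only meaningful when p.1 != q.1. *)
Definition slope (p q : point) : R := (q.2 - p.2) / (q.1 - p.1).

Definition distinct_x (s : seq point) : Prop := uniq [seq p.1 | p <- s].

Definition general_position (s : seq point) : Prop :=
  forall p q r, p \in s -> q \in s -> r \in s ->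
    p != q -> q != r -> p != r -> orient p q r != 0.

Definition convex_hull (s : seq point) (z : point) : Prop :=
  exists w : 'I_(size s) -> R,
    [/\ forall i, 0 <= w i,
        \sum_i w i = 1,
        z.1 = \sum_i w i * (nth (0, 0) s i).1
      & z.2 = \sum_i w i * (nth (0, 0) s i).2].

(* The input points on the upper boundary of the convex hull.  In general
   position these are the hull vertices met when walking clockwise from the
   leftmost point to the rightmost one, both included. *)
Definition upper_hull_point (s : seq point) (p : point) : Prop :=
  p \in s /\ forall z, convex_hull s z -> z.1 = p.1 -> z.2 <= p.2.

End Geometry.

(** * A fork-join RAM with geometric primitives

   An algorithm is a finite list of procedures.  A task executes one procedure;
   it can compute on its private memory, read and write the shared memory, call
   a procedure, or fork two procedure calls and wait for both of them.  Each
   forked task runs on a processor of its own, with a private memory that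
   initially holds its arguments only. *)

Inductive arith := Add | Sub | Mul | Div | Mod | Eq | Le | Lt.

(* [Priv a] is the content of the private cell whose address is the value of
   [a].  Truth values are the integers 0 and 1.  The coordinates of a point can
   be accessed through the last three primitives only. *)
Inductive expr :=
| Num of nat
| Priv of expr
| Arith of arith & expr & expr
| XLess of expr & expr
| LeftTurn of expr & expr & expr
| SlopeLess of expr & expr & expr & expr.

Inductive cmd :=
| Skip
| Assign of expr & expr               (* Priv[a] := e *)
| Read of expr & expr                 (* Priv[a] := Shared[e] *)
| Write of expr & expr                (* Shared[e] := e' *)
| Seq of cmd & cmd
| If of expr & cmd & cmd
| While of expr & cmd
| Call of expr & nat & seq expr       (* Priv[a] := f(es) *)
| Fork of expr & nat & seq expr & expr & nat & seq expr.
                                    (* Priv[a] := f(es) || Priv[b] := g(es') *)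

Definition program := seq cmd.

Definition arith_sem (o : arith) (i j : nat) : nat :=
  match o with
  | Add => i + j
  | Sub => i - j
  | Mul => i * j
  | Div => i %/ j
  | Mod => i %% j
  | Eq => i == j
  | Le => i <= j
  | Lt => i < j
  end.

(* Number of operations needed to evaluate an expression. *)
Fixpoint ops (e : expr) : nat :=
  match e with
  | Num _ => 1
  | Priv a => (ops a).+1
  | Arith _ e1 e2 | XLess e1 e2 => (ops e1 + ops e2).+1
  | LeftTurn e1 e2 e3 => (ops e1 + ops e2 + ops e3).+1
  | SlopeLess e1 e2 e3 e4 => (ops e1 + ops e2 + ops e3 + ops e4).+1
  end.

Definition ops_seq (es : seq expr) : nat := sumn (map ops es).

(* Resources used by (a part of) an execution:
   - the shared addresses read and written;
   - the length of the critical path, which is the maximal number of operations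
     performed by a processor, time spent waiting for forked tasks included,
     when every task has its own processor;
   - the peak number of words of private memory of any one processor, when
     every task has its own processor;
   - the peak total number of words of private memory of all suspended and
     running tasks when a single processor executes everything, depth first. *)
Record usage := Usage {
  reads : seq nat;
  writes : seq nat;
  span : nat;
  proc_space : nat;
  seq_space : nat }.

Definition then_ (u v : usage) : usage :=
  Usage (reads u ++ reads v) (writes u ++ writes v) (span u + span v)
        (maxn (proc_space u) (proc_space v)) (maxn (seq_space u) (seq_space v)).

(* The caller's [k] words stay in the memory of the processor executing the
   callee. *)
Definition above (k : nat) (u : usage) : usage :=
  Usage (reads u) (writes u) (span u) (k + proc_space u) (k + seq_space u).

(* Two tasks forked by a task holding [k] words. *)
Definition fork_ (k : nat) (u v : usage) : usage :=
  Usage (reads u ++ reads v) (writes u ++ writes v) (maxn (span u) (span v))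
        (maxn k (maxn (proc_space u) (proc_space v)))
        (k + maxn (seq_space u) (seq_space v)).

Definition race_free (u v : usage) : bool :=
  ~~ has (mem (writes u)) (reads v ++ writes v) &&
  ~~ has (mem (writes v)) (reads u).

Section Semantics.
Variable R : realFieldType.

Inductive val := Int of nat | Pt of point R.

(* The private memory of a procedure activation: cell a holds [nth (Int 0) m a].
   Writing at a new address extends the memory up to that address. *)
Definition frame := seq val.

Definition shared := nat -> val.

Definition upd (h : shared) (i : nat) (v : val) : shared :=
  fun j => if j == i then v else h j.

(* A cell can hold a point, which takes two words; one more word is needed for
   the point of control. *)
Definition words (m : frame) : nat := (size m).*2.+1.

Definition step (m : frame) (k : nat) (rs ws : seq nat) : usage :=
  Usage rs ws k (words m) (words m).

Section Program.
(* W bounds the integers that fit in a word; an expression that overflows has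
   no value, nor does an ill-typed one. *)
Variables (W : nat) (P : program).

Definition fit (i : nat) : option val := if i < W then Some (Int i) else None.

Fixpoint eval (m : frame) (e : expr) : option val :=
  match e with
  | Num i => fit i
  | Priv a =>
      if eval m a is Some (Int i) then Some (nth (Int 0) m i) else None
  | Arith o e1 e2 =>
      match eval m e1, eval m e2 with
      | Some (Int i), Some (Int j) => fit (arith_sem o i j)
      | _, _ => None
      end
  | XLess e1 e2 =>
      match eval m e1, eval m e2 with
      | Some (Pt p), Some (Pt q) => fit (p.1 < q.1)%R
      | _, _ => None
      end
  | LeftTurn e1 e2 e3 =>
      match eval m e1, eval m e2, eval m e3 with
      | Some (Pt p), Some (Pt q), Some (Pt r) => fit (0 < orient p q r)%R
      | _, _, _ => None
      end
  | SlopeLess e1 e2 e3 e4 =>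
      match eval m e1, eval m e2, eval m e3, eval m e4 with
      | Some (Pt p), Some (Pt q), Some (Pt r), Some (Pt t) =>
          fit (slope p q < slope r t)%R
      | _, _, _, _ => None
      end
  end.

(* [exec c m h m' h' u]: from private memory m and shared memory h, the command
   c terminates in private memory m' and shared memory h', using resources u.
   The result of a procedure is the content of its private cell 0.  There is no
   rule for a fork whose branches race (a cell written by one branch is read or
   written by the other one): such a fork gets stuck.  Without races the two
   branches do not see each other's writes, so each is run from the shared
   memory h of the fork, and the result is that of any interleaving. *)
Inductive exec : cmd -> frame -> shared -> frame -> shared -> usage -> Prop :=
| ExecSkip m h :
    exec Skip m h m h (step m 1 [::] [::])
| ExecAssign m h a e i v m' of
    eval m a = Some (Int i) & eval m e = Some v &
    m' = set_nth (Int 0) m i v :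
    exec (Assign a e) m h m' h (step m' (ops a + ops e).+1 [::] [::])
| ExecRead m h a e i j m' of
    eval m a = Some (Int i) & eval m e = Some (Int j) &
    m' = set_nth (Int 0) m i (h j) :
    exec (Read a e) m h m' h (step m' (ops a + ops e).+1 [:: j] [::])
| ExecWrite m h e e' j v of
    eval m e = Some (Int j) & eval m e' = Some v :
    exec (Write e e') m h m (upd h j v)
         (step m (ops e + ops e').+1 [::] [:: j])
| ExecSeq c1 c2 m h m1 h1 u1 m2 h2 u2 of
    exec c1 m h m1 h1 u1 & exec c2 m1 h1 m2 h2 u2 :
    exec (Seq c1 c2) m h m2 h2 (then_ u1 u2)
| ExecIf e c1 c2 m h b m' h' u of
    eval m e = Some (Int b) & exec (if b != 0 then c1 else c2) m h m' h' u :
    exec (If e c1 c2) m h m' h' (then_ (step m (ops e).+1 [::] [::]) u)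
| ExecWhileEnd e c m h of
    eval m e = Some (Int 0) :
    exec (While e c) m h m h (step m (ops e).+1 [::] [::])
| ExecWhile e c m h b m1 h1 u1 m2 h2 u2 of
    eval m e = Some (Int b) & b != 0 &
    exec c m h m1 h1 u1 & exec (While e c) m1 h1 m2 h2 u2 :
    exec (While e c) m h m2 h2
         (then_ (step m (ops e).+1 [::] [::]) (then_ u1 u2))
| ExecCall a f es m h i vs mf h' u m' of
    eval m a = Some (Int i) & map (eval m) es = map Some vs & f < size P &
    exec (nth Skip P f) vs h mf h' u &
    m' = set_nth (Int 0) m i (head (Int 0) mf) :
    exec (Call a f es) m h m' h'
         (then_ (above (words m) u)
                (step m' (ops a + ops_seq es).+1 [::] [::]))
| ExecFork a f es b g es' m h i j vs vs' mf hf uf mg hg ug m' of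
    eval m a = Some (Int i) & map (eval m) es = map Some vs & f < size P &
    eval m b = Some (Int j) & map (eval m) es' = map Some vs' & g < size P &
    exec (nth Skip P f) vs h mf hf uf &
    exec (nth Skip P g) vs' h mg hg ug &
    race_free uf ug &
    m' = set_nth (Int 0) (set_nth (Int 0) m i (head (Int 0) mf))
                 j (head (Int 0) mg) :
    exec (Fork a f es b g es') m h
         m' (fun k => if k \in writes uf then hf k else hg k)
         (then_ (fork_ (words m) uf ug)
                (step m' (ops a + ops_seq es + ops b + ops_seq es').+1
                      [::] [::])).

Lemma exec_det c m h m1 h1 u1 m2 h2 u2 :
  exec c m h m1 h1 u1 -> exec c m h m2 h2 u2 ->
  [/\ m1 = m2, h1 = h2 & u1 = u2].
Proof.
have someI : injective (@Some val) by move=> x y [].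
move=> E; elim: E m2 h2 u2 => {c m h m1 h1 u1}.
- by move=> m h m2 h2 u2 E; inversion E.
- move=> m h a e i v m' H1 H2 -> m2 h2 u2 E; inversion E; subst.
  split; congruence.
- move=> m h a e i v m' H1 H2 -> m2 h2 u2 E; inversion E; subst; split; congruence.
- move=> m h a e i v  H1 H2 m2 h2 u2 E; inversion E; subst; split; congruence.
- move=> c1 c2 m h m1 h1 u1 m2 h2 u2 _ I1 _ I2 m3 h3 u3 E; inversion E; subst.
  have [e1 e2 e3] := I1 _ _ _ ltac:(eassumption); subst.
  have [e1 e2 e3] := I2 _ _ _ ltac:(eassumption); subst. by [].
- move=> e c1 c2 m h b m' h' u H _ I m2 h2 u2 E; inversion E; subst.
  have Eb : b0 = b by congruence. subst b0.
  have [e1 e2 e3] := I _ _ _ ltac:(eassumption); subst. by [].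
- move=> e c m h H m2 h2 u2 E; inversion E; subst => //.
  have Eb : b = 0 by congruence. by subst b.
- move=> e c m h b m1 h1 u1 m2 h2 u2 H Hb _ I1 _ I2 m3 h3 u3 E; inversion E; subst.
    have Eb : b = 0 by congruence. by subst b.
  have [e1 e2 e3] := I1 _ _ _ ltac:(eassumption); subst.
  have [e1 e2 e3] := I2 _ _ _ ltac:(eassumption); subst. by [].
- move=> a f es m h i vs mf h' u m' Ha Hs _ _ I -> m2 h2 u2 E; inversion E; subst.
  have Ev : vs0 = vs by apply: (inj_map someI); congruence.
  subst vs0. have [e1 e2 e3] := I _ _ _ ltac:(eassumption); subst. split; congruence.
- move=> a f es b g es' m h i j vs vs' mf hf uf mg hg ug m'.
  move=> Ha Hs _ Hb Hs' _ _ I1 _ I2 _ -> m2 h2 u2 E; inversion E; subst.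
  have Ev : vs0 = vs by apply: (inj_map someI); congruence.
  have Ev' : vs'0 = vs' by apply: (inj_map someI); congruence.
  subst vs0 vs'0.
  have [e1 e2 e3] := I1 _ _ _ ltac:(eassumption); subst.
  have [e1 e2 e3] := I2 _ _ _ ltac:(eassumption); subst.
  have -> : i = i0 by congruence. have -> : j = j0 by congruence. by [].
Qed.

End Program.

(* The input array s occupies the addresses 0, ..., size s - 1. *)
Definition input_memory (s : seq (point R)) : shared :=
  fun i => if i < size s then Pt (nth (0, 0)%R s i) else Int 0.

(* Execution of P on input s: procedure 0 is called with the integer size s,
   and returns r.  Integers are below (size s + 2) ^ c, that is, a word has
   O(log (size s)) bits. *)
Definition run (c : nat) (P : program) (s : seq (point R))
    (r : val) (h : shared) (u : usage) : Prop :=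
  exists2 m, r = head (Int 0) m &
    [/\ 0 < size P &
        exec ((size s).+2 ^ c) P (nth Skip P 0) [:: Int (size s)]
             (input_memory s) m h u].

(* The addresses from n on are not part of the input: a shared cell is
   allocated when such an address is used. *)
Definition allocated (n : nat) (u : usage) : seq nat :=
  undup [seq i <- reads u ++ writes u | n <= i].

Definition log (n : nat) : nat := trunc_log 2 n.

Section Specification.
Variables (c : nat) (P : program) (valid : seq (point R) -> Prop).

Definition terminates : Prop :=
  forall s, valid s -> exists r h u, run c P s r h u.

(* The cost is O(g n) for inputs of size n. *)
Definition cost_bigO (cost : nat -> usage -> nat) (g : nat -> nat) : Prop :=
  exists C N, forall s r h u, valid s -> N <= size s -> run c P s r h u ->
    cost (size s) u <= C * g (size s).

Definition strong_PIP : Prop :=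
  [/\ terminates,
      forall s r h u, valid s -> run c P s r h u ->
        allocated (size s) u = [::],
      cost_bigO (fun _ u => proc_space u) log,
      (exists k, cost_bigO (fun _ u => span u) (fun n => log n ^ k)) &
      cost_bigO (fun n u => seq_space u + (size (allocated n u)).*2) log].

End Specification.

Definition valid_input (s : seq (point R)) : Prop :=
  general_position s /\ distinct_x s.

(* The array has been permuted into t, its first k points are the upper hull
   points from left to right, and k is the result returned. *)
Definition upper_hull_output (s : seq (point R)) (r : val) (h : shared) :
    Prop :=
  exists (t : seq (point R)) (k : nat),
    [/\ perm_eq t s /\ (forall i, i < size t -> h i = Pt (nth (0, 0)%R t i)),
        r = Int k /\ k <= size t,
        sorted (fun p q : point R => p.1 < q.1)%R (take k t) &
        forall p, p \in take k t <-> upper_hull_point s p].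

Definition constructs_upper_hull (c : nat) (P : program) : Prop :=
  forall s r h u, valid_input s -> run c P s r h u -> upper_hull_output s r h.

End Semantics.

(* Main.v *)
Require Import Defs.
From mathcomp Require Import all_boot all_order all_algebra.
From mathcomp Require Import zify ring lra.

(* The amount of work is not limited, so that every quantity which depends on an
   unchanging array (whether a point lies below a segment, how many points lie
   to the left of a point, ...) is computed by brute force in nested parallel
   loops, in logarithmic span and without writing anything.

   The array is split at its median x-coordinate by a stable partition, the two
   parts are solved in parallel, and the two hulls are merged.  If u is on the
   upper hull of the whole set, w is to the left of u, and w is below a segment
   that ends to the right of u, then w is also below the segment with the same
   left end and right end u.  So the points of the left hull that remain on the
   hull of the union form a prefix of it, those of the right hull form a suffix,
   and both partitioning and merging move points by rotating a block of the
   array, that is, by three reversals, whose swaps do not interfere. *)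

Set Implicit Arguments.
Unset Strict Implicit.
Unset Printing Implicit Defensive.

Import Order.TTheory GRing.Theory Num.Theory.

Notation cell i := (Priv (Defs.Num i)).

(** * Resource triples *)

Section Triples.
Variables (R : realFieldType) (W : nat) (P : program).
Notation val := (Defs.val R).
Notation frame := (seq val).
Notation shared := (Defs.shared R).
Implicit Types (c : cmd) (m : frame) (h : shared) (A : nat -> Prop).
Implicit Types (Q : frame -> shared -> Prop) (ro : bool) (u : usage).

Lemma exec_frame c m h m' h' u :
  exec W P c m h m' h' u -> forall k, k \notin writes u -> h' k = h k.
Proof.
elim=> //= {c m h m' h' u}.
- by move=> m h e e' j v _ _ k; rewrite /upd inE => /negPf->.
- move=> c1 c2 m h m1 h1 u1 m2 h2 u2 _ I1 _ I2 k.
  by rewrite mem_cat negb_or => /andP[k1 k2]; rewrite I2 ?I1.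
- move=> e c m h b m1 h1 u1 m2 h2 u2 _ _ _ I1 _ I2 k.
  by rewrite mem_cat negb_or => /andP[k1 k2]; rewrite I2 ?I1.
- move=> a f es m h i vs mf h' u m' _ _ _ _ I _ k.
  by rewrite cats0; apply: I.
- move=> a f es b g es' m h i j vs vs' mf hf uf mg hg ug m'.
  move=> _ _ _ _ _ _ _ I1 _ I2 _ _ k.
  by rewrite cats0 mem_cat negb_or => /andP[/negPf k1 k2]; rewrite k1 I2.
Qed.

(** Calls charge both peaks alike, while a fork takes a maximum in the first and adds the caller's
    words in the second. Hence only sequential space is tracked below. *)
Lemma proc_space_le_seq_space c m h m' h' u :
  exec W P c m h m' h' u -> proc_space u <= seq_space u.
Proof. by elim=> //= *; lia. Qed.

(* [ro] asserts that nothing is written; [A] bounds the addresses accessed,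
   [s] the span and [t] the sequential space. *)
Definition wp c m h ro A (s t : nat) Q : Prop :=
  exists m' h' u, [/\ exec W P c m h m' h' u,
    (ro -> writes u = [::]) /\ (forall k, k \in reads u ++ writes u -> A k),
    Defs.span u <= s, seq_space u <= t & Q m' h'].

Lemma wp_conseq ro' A' s' t' Q' c m h ro A s t Q :
  wp c m h ro' A' s' t' Q' -> (ro -> ro') -> (forall k, A' k -> A k) ->
  s' <= s -> t' <= t -> (forall m' h', Q' m' h' -> Q m' h') ->
  wp c m h ro A s t Q.
Proof.
move=> [m' [h' [u [E [H1 H2] Hs Ht HQ]]]] Hro HA ls lt HQQ.
exists m', h', u; split=> //; try lia; last exact: HQQ.
by split=> [/Hro/H1|k /H2 /HA].
Qed.

Lemma wp_span s' c m h ro A s t Q :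
  wp c m h ro A s' t Q -> s' <= s -> wp c m h ro A s t Q.
Proof. by move=> H l; apply: (wp_conseq H). Qed.

(** Postconditions speak of the block that a command works on; this recovers the rest of the memory,
    so that other blocks survive a call. *)
Lemma wp_framed c m h ro A s t Q :
  wp c m h ro A s t Q ->
  wp c m h ro A s t (fun m' h' => [/\ Q m' h', forall k, ~ A k -> h' k = h k
                                  & ro -> forall k, h' k = h k]).
Proof.
move=> [m' [h' [u [E [H1 H2] Hs Ht HQ]]]]; exists m', h', u; split=> //.
split=> // [k nA | /H1 u0 k]; apply: (exec_frame E); last by rewrite u0.
by apply/negP=> ku; apply: nA; apply: H2; rewrite mem_cat ku orbT.
Qed.

Lemma wp_seq c1 c2 m h ro A s1 s2 t Q :
  wp c1 m h ro A s1 t (fun m1 h1 => wp c2 m1 h1 ro A s2 t Q) ->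
  wp (Seq c1 c2) m h ro A (s1 + s2) t Q.
Proof.
move=> [m1 [h1 [u1 [E1 [w1 a1] l1 t1 [m2 [h2 [u2 [E2 [w2 a2] l2 t2 HQ]]]]]]]].
exists m2, h2, (then_ u1 u2); split=> //=; [exact: ExecSeq E1 E2| |lia|lia].
split=> [r|k]; first by rewrite w1 ?w2.
rewrite !mem_cat => /orP[/orP[]|/orP[]] H; [apply: a1|apply: a2|apply: a1|apply: a2];
  by rewrite mem_cat H ?orbT.
Qed.

Lemma wp_assign a e i v m h ro A t Q :
  eval W m a = Some (Int R i) -> eval W m e = Some v ->
  words (set_nth (Int R 0) m i v) <= t -> Q (set_nth (Int R 0) m i v) h ->
  wp (Assign a e) m h ro A (ops a + ops e).+1 t Q.
Proof.
move=> Ha He Ht HQ; do 3 eexists; split; first exact: ExecAssign Ha He erefl.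
all: by [].
Qed.

Lemma wp_read a e i j m h ro A t Q :
  eval W m a = Some (Int R i) -> eval W m e = Some (Int R j) -> A j ->
  words (set_nth (Int R 0) m i (h j)) <= t ->
  Q (set_nth (Int R 0) m i (h j)) h ->
  wp (Read a e) m h ro A (ops a + ops e).+1 t Q.
Proof.
move=> Ha He Aj Ht HQ; do 3 eexists; split; [exact: ExecRead Ha He erefl| |by []|by []|by []].
by split=> // k; rewrite !inE => /eqP->.
Qed.

Lemma wp_write e e' j v m h A t Q :
  eval W m e = Some (Int R j) -> eval W m e' = Some v -> A j ->
  words m <= t -> Q m (upd h j v) ->
  wp (Write e e') m h false A (ops e + ops e').+1 t Q.
Proof.
move=> He He' Aj Ht HQ; do 3 eexists; split; [exact: ExecWrite He He'| |by []|by []|by []].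
by split=> // k; rewrite !inE => /eqP->.
Qed.

Lemma wp_if b e c1 c2 m h ro A s t Q :
  eval W m e = Some (Int R b) -> words m <= t ->
  wp (if b != 0 then c1 else c2) m h ro A s t Q ->
  wp (If e c1 c2) m h ro A ((ops e).+1 + s) t Q.
Proof.
move=> He Ht [m1 [h1 [u1 [E1 [w1 a1] l1 t1 HQ]]]].
do 3 eexists; split; first exact: ExecIf He E1.
all: by rewrite //=; lia.
Qed.

(** Frames keep at most 16 cells, that is 33 words, so [33 <= t] pays for the caller's frame once
    the result is stored. *)
Lemma wp_call a f es i vs m h ro A s t t' Q :
  eval W m a = Some (Int R i) -> map (eval W m) es = map Some vs ->
  f < size P ->
  wp (nth Skip P f) vs h ro A s t'
     (fun mf h' => Q (set_nth (Int R 0) m i (head (Int R 0) mf)) h') ->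
  maxn (size m) i.+1 <= 16 -> words m + t' <= t -> 33 <= t ->
  wp (Call a f es) m h ro A (s + (ops a + ops_seq es).+1) t Q.
Proof.
move=> Ha Hes Hf [mf [h' [u [E [w1 a1] l1 t1 HQ]]]] Hi Ht Ht'.
do 3 eexists; split; [exact: ExecCall Ha Hes Hf E erefl| | | |exact: HQ] => /=.
- by rewrite !cats0.
- lia.
- by rewrite /words size_set_nth in Ht *; lia.
Qed.

Lemma wp_call_spec a f es i vs m h ro ro' A A' s t t' Q Q' :
  wp (nth Skip P f) vs h ro' A' s t' Q' ->
  eval W m a = Some (Int R i) -> map (eval W m) es = map Some vs ->
  f < size P -> (ro -> ro') -> (forall k, A' k -> A k) ->
  maxn (size m) i.+1 <= 16 -> words m + t' <= t -> 33 <= t ->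
  (forall mf h', Q' mf h' -> (forall k, ~ A' k -> h' k = h k) ->
     (ro' -> forall k, h' k = h k) ->
     Q (set_nth (Int R 0) m i (head (Int R 0) mf)) h') ->
  wp (Call a f es) m h ro A (s + (ops a + ops_seq es).+1) t Q.
Proof.
move=> H Ha Hes Hf Hro HA Hi Ht Ht' HQ; apply: wp_call Ha Hes Hf _ Hi Ht Ht'.
by apply: (wp_conseq (wp_framed H)) => // mf h' [H1 H2 H3]; apply: HQ.
Qed.

(** Races are excluded in one of two ways: both branches only read, and may share addresses, or
    their address sets are disjoint. *)
Lemma wp_fork a f es b g es' i j vs vs' m h ro A Af Ag sf sg t' t Qf Qg Q :
  eval W m a = Some (Int R i) -> map (eval W m) es = map Some vs ->
  f < size P ->
  eval W m b = Some (Int R j) -> map (eval W m) es' = map Some vs' ->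
  g < size P ->
  wp (nth Skip P f) vs h ro Af sf t' Qf ->
  wp (nth Skip P g) vs' h ro Ag sg t' Qg ->
  (forall k, Af k -> A k) -> (forall k, Ag k -> A k) ->
  ro \/ (forall k, Af k -> ~ Ag k) ->
  maxn (size m) (maxn i.+1 j.+1) <= 16 -> words m + t' <= t -> 33 <= t ->
  (forall mf hf mg hg h', Qf mf hf -> Qg mg hg ->
     (forall k, Af k -> h' k = hf k) -> (forall k, Ag k -> h' k = hg k) ->
     (forall k, ~ Af k -> ~ Ag k -> h' k = h k) ->
     Q (set_nth (Int R 0) (set_nth (Int R 0) m i (head (Int R 0) mf)) j
                (head (Int R 0) mg)) h') ->
  wp (Fork a f es b g es') m h ro A
     (maxn sf sg + (ops a + ops_seq es + ops b + ops_seq es').+1) t Q.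
Proof.
move=> Ha Hes Hf Hb Hes' Hg [mf [hf [uf [Ef [wf af] lf tf HQf]]]].
move=> [mg [hg [ug [Eg [wg ag] lg tg HQg]]]] sAf sAg D Hij Ht Ht' HQ.
have nwf k : k \in writes uf -> Af k.
  by move=> H; apply: af; rewrite mem_cat H orbT.
have nwg k : k \in writes ug -> Ag k.
  by move=> H; apply: ag; rewrite mem_cat H orbT.
have rf : race_free uf ug.
  case: D => [r|D].
    by rewrite /race_free wf // wg //=; apply/andP; split; apply/hasPn.
  rewrite /race_free; apply/andP; split; apply/hasPn => k /=.
    by move=> /ag Hk; apply/negP => /nwf /D.
  by move=> Hk; apply/negP => /nwg; apply: D; apply: af; rewrite mem_cat Hk.
do 3 eexists; split; [exact: ExecFork Ha Hes Hf Hb Hes' Hg Ef Eg rf erefl| | | |].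
- split=> /= [r|k]; first by rewrite wf ?wg.
  rewrite !cats0 !mem_cat => /orP[/orP[]|/orP[]] H;
  [apply/sAf/af|apply/sAg/ag|apply/sAf/af|apply/sAg/ag];
  by rewrite mem_cat H ?orbT.
- by rewrite /=; lia.
- by rewrite /= /words !size_set_nth in Ht *; lia.
apply: (HQ _ _ _ _ _ HQf HQg) => k.
(* An address of [Af] that the first branch did not write still has its value in [h], and the second
   branch cannot have written it. *)
- case: ifP => // /negbT kf Ak; rewrite (exec_frame Ef) //.
  rewrite (exec_frame Eg) //; apply/negP => kg; case: D => [r|/(_ k Ak)].
    by rewrite wg in kg.
  by apply; apply: nwg.
- case: ifP => // kf Ak; case: D => [r|/(_ k)]; first by rewrite wf in kf.
  by move=> /(_ (nwf _ kf)).
- move=> nf ng; case: ifP => [/nwf//|_].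
  by apply: (exec_frame Eg); apply/negP => /nwg.
Qed.

(** * Evaluation of expressions *)

Lemma eval_num m i : i < W -> eval W m (Defs.Num i) = Some (Int R i).
Proof. by rewrite /= /fit => ->. Qed.

Lemma eval_cell m i v : i < W -> nth (Int R 0) m i = v ->
  eval W m (cell i) = Some v.
Proof. by move=> iW <-; rewrite /= /fit iW. Qed.

Lemma eval_arith o m e1 e2 i j :
  eval W m e1 = Some (Int R i) -> eval W m e2 = Some (Int R j) ->
  arith_sem o i j < W -> eval W m (Arith o e1 e2) = Some (Int R (arith_sem o i j)).
Proof. by move=> /= -> -> H; rewrite /fit H. Qed.

Lemma eval_xless m e1 e2 p q : 1 < W ->
  eval W m e1 = Some (Pt p) -> eval W m e2 = Some (Pt q) ->
  eval W m (XLess e1 e2) = Some (Int R (p.1 < q.1)%R).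
Proof. by move=> H /= -> ->; rewrite /fit; case: (_ < _)%R => /=; rewrite ?H // ltnW. Qed.

Lemma eval_left m e1 e2 e3 p q r : 1 < W ->
  eval W m e1 = Some (Pt p) -> eval W m e2 = Some (Pt q) ->
  eval W m e3 = Some (Pt r) ->
  eval W m (LeftTurn e1 e2 e3) = Some (Int R (0 < orient p q r)%R).
Proof. by move=> H /= -> -> ->; rewrite /fit; case: (_ < _)%R => /=; rewrite ?H // ltnW. Qed.

End Triples.

Section EvalSeq.
Variables (R : realFieldType) (W : nat).

Lemma evals_nil (m : seq (Defs.val R)) : map (eval W m) [::] = map Some [::].
Proof. by []. Qed.

Lemma evals_cons (m : seq (Defs.val R)) e es v vs :
  eval W m e = Some v -> map (eval W m) es = map Some vs ->
  map (eval W m) (e :: es) = map Some (v :: vs).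
Proof. by move=> /= -> ->. Qed.

Lemma evals_cells (m0 env : seq (Defs.val R)) : size m0 + size env <= W ->
  map (eval W (m0 ++ env)) [seq cell i | i <- iota (size m0) (size env)] =
  map Some env.
Proof.
elim: env m0 => //= v env IH m0 H.
have -> : fit R W (size m0) = Some (Int R (size m0)).
  by rewrite /fit ifT //; lia.
rewrite nth_cat ltnn subnn /=; congr cons.
by have := IH (rcons m0 v); rewrite size_rcons cat_rcons; apply; lia.
Qed.

End EvalSeq.

Ltac small_num :=
  match goal with
  | H : is_true (64 <= ?W) |- _ => apply: leq_trans H; exact: isT
  | _ => lia
  end.

Ltac ev :=
  lazymatch goal with
  | |- eval _ _ (Defs.Num _) = _ => apply: eval_num; small_num
  | |- eval _ _ (Priv _) = _ => eapply eval_cell; [small_num | cbn [nth]; reflexivity]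
  | |- eval _ _ (Arith _ _ _) = _ =>
      eapply eval_arith; [ev | ev | rewrite [arith_sem _ _ _]/=; try lia]
  | |- eval _ _ (XLess _ _) = _ => eapply eval_xless; [small_num | ev | ev]
  | |- eval _ _ (LeftTurn _ _ _) = _ => eapply eval_left; [small_num | ev | ev | ev]
  end.

Ltac bound := rewrite /words /ops_seq /=; lia.

Ltac evs :=
  lazymatch goal with
  | |- map _ [::] = _ => apply: evals_nil
  | |- map _ (_ :: _) = _ => eapply evals_cons; [ev | evs]
  end.

Notation env_cells e := [seq cell i | i <- iota 2 e].

(** * Parallel loops *)

(* Parallel loop over the addresses [lo, lo + n): cells 0 and 1 hold lo and n,
   the next e cells are passed unchanged to the body, which finds its index in
   cell 0; the results of the iterations are added up. *)
Definition par_for (f e : nat) (body : cmd) : cmd :=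
  If (Arith Le (cell 1) (Defs.Num 1))
     (If (Arith Eq (cell 1) (Defs.Num 0)) (Assign (Defs.Num 0) (Defs.Num 0)) body)
     (Seq (Fork (Defs.Num 0) f
             [:: cell 0, Arith Div (cell 1) (Defs.Num 2) & env_cells e]
             (Defs.Num 1) f
             [:: Arith Add (cell 0) (Arith Div (cell 1) (Defs.Num 2)),
                 Arith Defs.Sub (cell 1) (Arith Div (cell 1) (Defs.Num 2))
               & env_cells e])
          (Assign (Defs.Num 0) (Arith Add (cell 0) (cell 1)))).

Section ParFor.
Variables (R : realFieldType) (W : nat) (P : program).
Notation val := (Defs.val R).

(** [A i] is what iteration [i] may access and [g] the final content of all these addresses. The
    forks form a binary tree of depth at most [L], of constant cost per level; [s] and [t] are paid
    once, since span is a maximum over branches and sequential space holds one branch at a time. *)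
Lemma wp_par_for f e body (env : seq val) h ro (A : nat -> nat -> Prop) g F s t
    L lo n :
  f < size P -> nth Skip P f = par_for f e body -> size env = e -> e <= 4 ->
  (forall i, lo <= i < lo + n ->
     wp W P body [:: Int R i, Int R 1 & env] h ro (A i) s t
        (fun m' h' => head (Int R 0) m' = Int R (F i) /\
                      forall k, A i k -> h' k = g k)) ->
  ro \/ (forall i j k, A i k -> A j k -> i = j) ->
  n <= 2 ^ L -> 16 <= W -> lo + n < W -> \sum_(lo <= i < lo + n) F i < W ->
  33 <= t ->
  wp W P (nth Skip P f) [:: Int R lo, Int R n & env] h ro
     (fun k => exists2 i, lo <= i < lo + n & A i k)
     (100 * L.+1 + s) (40 * L + t)
     (fun m' h' =>
        head (Int R 0) m' = Int R (\sum_(lo <= i < lo + n) F i) /\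
        forall k, (exists2 i, lo <= i < lo + n & A i k) -> h' k = g k).
Proof.
move=> fP Pf ee e4 Hbody D Hn W16 HW HF Ht.
(* Stated for all subranges and all [L'], as ranges of length at most one occur for [L = 0] and also
   at earlier levels. *)
have base lo' n' L' : n' <= 1 -> lo <= lo' -> lo' + n' <= lo + n ->
    wp W P (nth Skip P f) [:: Int R lo', Int R n' & env] h ro
       (fun k => exists2 i, lo' <= i < lo' + n' & A i k)
       (100 * L'.+1 + s) (40 * L' + t)
       (fun m' h' =>
          head (Int R 0) m' = Int R (\sum_(lo' <= i < lo' + n') F i) /\
          forall k, (exists2 i, lo' <= i < lo' + n' & A i k) -> h' k = g k).
  case: n' => [|[|//]] _ l1 l2; rewrite Pf /par_for.
    eapply wp_span; first eapply wp_if; [ev|rewrite /words /= ee; lia|rewrite /=|].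
      eapply wp_if; [ev|rewrite /words /= ee; lia|rewrite /=].
      eapply wp_assign; [ev|ev|rewrite /words /= ee; lia|].
      by rewrite addn0 big_geq //; split=> // k [i]; lia.
    by rewrite /=; lia.
  eapply wp_span; first eapply wp_if; [ev|rewrite /words /= ee; lia|rewrite /=|].
    eapply wp_if; [ev|rewrite /words /= ee; lia|rewrite /=].
    apply: (wp_conseq (Hbody lo' _)) => //; try lia.
      by move=> k Ak; exists lo' => //; lia.
    move=> m' h' [-> Hh]; rewrite addn1 big_nat1; split=> // k [i Hi Ak].
    by apply: Hh; have -> : lo' = i by lia.
  by rewrite /=; lia.
elim: L lo n Hbody Hn HW HF base => [|L IH] lo n Hbody Hn HW HF base.
  by apply: base => //; rewrite expn0 in Hn.
have [n1|n1] := leqP n 1; first exact: base.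
rewrite Pf /par_for.
have n2 : n %/ 2 <= 2 ^ L by rewrite expnS in Hn; lia.
have n3 : n - n %/ 2 <= 2 ^ L by rewrite expnS in Hn; lia.
have Hs : \sum_(lo <= i < lo + n) F i =
    \sum_(lo <= i < lo + n %/ 2) F i + \sum_(lo + n %/ 2 <= i < lo + n) F i.
  by apply: big_cat_nat; lia.
have El : lo + n %/ 2 + (n - n %/ 2) = lo + n by lia.
have I1 := IH lo (n %/ 2) _ n2 _ _ _.
have I2 := IH (lo + n %/ 2) (n - n %/ 2) _ n3 _ _ _.
rewrite El in I2.
have {}I1 := I1 ltac:(by move=> i Hi; apply: Hbody; lia) ltac:(lia) ltac:(lia)
  ltac:(by move=> *; apply: base; lia).
have {}I2 := I2 ltac:(by move=> i Hi; apply: Hbody; lia) ltac:(lia) ltac:(lia)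
  ltac:(by move=> *; apply: base; lia).
apply: (@wp_span _ _ _ (100 + (100 * L.+1 + s))); last lia.
eapply wp_span; first eapply wp_if; [ev|rewrite /words /= ee; lia| |].
  have -> : (arith_sem Le n 1 : nat) = 0 by rewrite /=; lia.
  rewrite /=; apply: wp_seq.
  eapply wp_fork; [ev| |exact: fP|ev| |exact: fP|exact: I1|exact: I2
    | | | | |rewrite /words /= ee; lia| |].
    + eapply evals_cons; [ev|eapply evals_cons; [ev|]].
      by rewrite -ee; apply: (evals_cells (m0 := [:: _; _])); rewrite /= ee; lia.
    + eapply evals_cons; [ev|eapply evals_cons; [ev|]].
      by rewrite -ee; apply: (evals_cells (m0 := [:: _; _])); rewrite /= ee; lia.
    + by move=> k [i Hi Ak]; exists i => //; lia.
    + by move=> k [i Hi Ak]; exists i => //; lia.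
    + case: D => [r|D]; [by left|right] => k [i Hi Ai] [j Hj Aj].
      by have := D _ _ _ Ai Aj; lia.
    + by rewrite /= ee; lia.
    + by lia.
    + move=> mf hf mg hg h' [Hf1 Hf2] [Hg1 Hg2] H1 H2 _; rewrite Hf1 Hg1 /=.
      eapply wp_assign; [ev|ev|rewrite /words /= ee; lia|rewrite /=].
      split; first by rewrite Hs.
      move=> k [i Hi Ai]; have [il|il] := ltnP i (lo + n %/ 2).
        by rewrite H1 ?Hf2 //; exists i => //; lia.
      by rewrite H2 ?Hg2 //; exists i => //; lia.
rewrite /ops_seq /= -!map_comp /=.
have -> : sumn [seq (ops \o (fun i => cell i)) i | i <- iota 2 e] = 2 * e.
  rewrite (eq_map (g := fun=> 2)) // -[in RHS](size_iota 2 e).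
  by elim: (iota 2 e) => //= _ l ->; lia.
lia.
Qed.

End ParFor.

(** * Points below no segment *)

Section Exposed.
Variable R : realFieldType.
Implicit Types (p q r u v w : point R) (s : seq (point R)).

(** If the head fails [a], so does every later element. *)
Lemma filter_prefix (T : eqType) (e : rel T) (a : pred T) (s : seq T) :
  pairwise e s -> {in s &, forall x y, e x y -> a y -> a x} ->
  filter a s = take (count a s) s.
Proof.
elim: s => //= x s IH /andP[xs ps] H.
have {}IH : filter a s = take (count a s) s.
  by apply: IH => // y z ys zs; apply: H; rewrite inE ?ys ?zs orbT.
case: ifP => /= ax; first by rewrite IH.
have c0 : count a s = 0.
  apply/eqP; rewrite -leqn0 leqNgt -has_count; apply/hasPn => y ys.
  by apply/negP => ay; rewrite (H x y) ?inE ?eqxx ?ys ?orbT // (allP xs) in ax.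
by rewrite IH c0 take0.
Qed.

(** Once the head satisfies [a], so does everything after it; the number of dropped elements is that
    of those failing [a]. *)
Lemma filter_suffix (T : eqType) (e : rel T) (a : pred T) (s : seq T) :
  pairwise e s -> {in s &, forall x y, e x y -> a x -> a y} ->
  filter a s = drop (size s - count a s) s.
Proof.
rewrite -(count_predC a) addKn.
elim: s => //= x s IH /andP[xs ps] H.
have {}IH : filter a s = drop (count (predC a) s) s.
  by apply: IH => // y z ys zs; apply: H; rewrite inE ?ys ?zs orbT.
case: ifP => /= ax; last by [].
have aS : all a s by apply/allP => y ys; apply: (H x y); rewrite ?inE ?eqxx ?ys ?orbT // (allP xs).
have -> : count (predC a) s = 0.
  by apply/eqP; rewrite -leqn0 leqNgt -has_count has_predC aS.
by rewrite drop0; congr cons; apply/all_filterP.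
Qed.

Local Open Scope ring_scope.

(** Given the order of the abscissas, the left turn at [p] means that [p] lies strictly below the
    segment from [q] to [r]. *)
Definition below p q r : bool := [&& q.1 < p.1, p.1 < r.1 & 0 < orient q p r].

Definition exposed s p : bool := ~~ has (fun q => has (below p q) s) s.

Lemma exposedP s p :
  reflect (forall q r, q \in s -> r \in s -> ~~ below p q r) (exposed s p).
Proof.
apply: (iffP hasPn) => [H q r qs rs|H q qs]; first by move/hasPn: (H q qs); apply.
by apply/hasPn => r; apply: H.
Qed.

Lemma exposed_sub s s' p : {subset s <= s'} -> exposed s' p -> exposed s p.
Proof. by move=> ss /exposedP H; apply/exposedP => q r /ss qs /ss; apply: H. Qed.

(** As [u] is on or above the segment from [q] to [r], the segment from [q] to [u] runs on or above
    it, hence above [p]. *)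
Lemma below_replace_right p q r u :
  below p q r -> p.1 < u.1 -> u.1 < r.1 -> ~~ below u q r -> below p q u.
Proof.
rewrite /below /orient => /and3P[qp pr o1] pu ur.
rewrite (lt_trans qp pu) ur qp pu /= -leNgt => o2.
have qr : 0 < r.1 - q.1 by rewrite subr_gt0 (lt_trans qp).
rewrite -(pmulr_rgt0 _ qr).
(* A linear relation expressing [orient q p u] by [orient q p r], which is positive, and
   [orient q u r], which is not. *)
have -> : (r.1 - q.1) * ((p.1 - q.1) * (u.2 - q.2) - (p.2 - q.2) * (u.1 - q.1)) =
  (u.1 - q.1) * ((p.1 - q.1) * (r.2 - q.2) - (p.2 - q.2) * (r.1 - q.1))
  - (p.1 - q.1) * ((u.1 - q.1) * (r.2 - q.2) - (u.2 - q.2) * (r.1 - q.1)) by ring.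
rewrite subr_gt0 (@le_lt_trans _ _ 0) //.
  by rewrite pmulr_rle0 ?subr_gt0.
by rewrite mulr_gt0 // subr_gt0 (lt_trans qp).
Qed.

Lemma below_replace_left p q r u :
  below p q r -> u.1 < p.1 -> q.1 < u.1 -> ~~ below u q r -> below p u r.
Proof.
rewrite /below /orient => /and3P[qp pr o1] up qu.
rewrite (lt_trans up pr) qu pr up /= -leNgt => o2.
have qr : 0 < r.1 - q.1 by rewrite subr_gt0 (lt_trans qp).
rewrite -(pmulr_rgt0 _ qr).
have -> : (r.1 - q.1) * ((p.1 - u.1) * (r.2 - u.2) - (p.2 - u.2) * (r.1 - u.1)) =
  (r.1 - u.1) * ((p.1 - q.1) * (r.2 - q.2) - (p.2 - q.2) * (r.1 - q.1))
  - (r.1 - p.1) * ((u.1 - q.1) * (r.2 - q.2) - (u.2 - q.2) * (r.1 - q.1)) by ring.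
rewrite subr_gt0 (@le_lt_trans _ _ 0) //.
  by rewrite pmulr_rle0 ?subr_gt0.
by rewrite mulr_gt0 // subr_gt0 (lt_trans up).
Qed.

Definition x_lt : rel (point R) := fun p q => p.1 < q.1.

Definition is_hull s (H : seq (point R)) : Prop :=
  pairwise x_lt H /\ forall p, (p \in H) = (p \in s) && exposed s p.

(** A point exposed in the union is exposed in its own part, so filtering the two lists suffices;
    closure along the x-order turns the filters into a prefix and a suffix. *)
Lemma is_hull_merge s1 s2 s H1 H2 :
  {in s1 & s2, forall p q, p.1 < q.1} -> s =i s1 ++ s2 ->
  is_hull s1 H1 -> is_hull s2 H2 ->
  is_hull s (take (count (exposed s) H1) H1 ++
             drop (size H2 - count (exposed s) H2) H2).
Proof.
move=> s12 Es [pw1 m1] [pw2 m2].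
have sub1 : {subset s1 <= s} by move=> p p1; rewrite Es mem_cat p1.
have sub2 : {subset s2 <= s} by move=> p p2; rewrite Es mem_cat p2 orbT.
rewrite -(filter_prefix pw1); last first.
  move=> w u; rewrite !m1 => /andP[w1 xw] /andP[u1 _] wu /exposedP xu.
  apply/exposedP => q r; rewrite !Es !mem_cat => qs rs; apply/negP => B.
  have [qw wr _] := and3P B.
  have q1 : q \in s1.
    by case/orP: qs => // q2; have := lt_trans (s12 _ _ w1 q2) qw; rewrite ltxx.
  case/orP: rs => rs; first by have /exposedP/(_ q r q1 rs) := xw; rewrite B.
  (* Here [r] is to the right of [u]; replacing it by [u] puts [w] below a segment inside [s1]. *)
  have /exposedP/(_ q u q1 u1)/negP := xw; apply.
  apply: (below_replace_right B) => //; first exact: s12.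
  by apply: xu; rewrite ?Es ?mem_cat ?q1 ?rs ?orbT.
rewrite -(filter_suffix pw2); last first.
  move=> u w; rewrite !m2 => /andP[u1 _] /andP[w1 xw] uw /exposedP xu.
  apply/exposedP => q r; rewrite !Es !mem_cat => qs rs; apply/negP => B.
  have [qw wr _] := and3P B.
  have r1 : r \in s2.
    by case/orP: rs => // r2; have := lt_trans (s12 _ _ r2 w1) wr; rewrite ltxx.
  case/orP: qs => qs; last by have /exposedP/(_ q r qs r1) := xw; rewrite B.
  have /exposedP/(_ u r u1 r1)/negP := xw; apply.
  apply: (below_replace_left B) => //; first exact: s12.
  by apply: xu; rewrite ?Es ?mem_cat ?qs ?r1 ?orbT.
split=> [|p].
  rewrite pairwise_cat !(@subseq_pairwise _ _ _ _ (filter_subseq _ _)) // !andbT.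
  apply/allrelP => p q; rewrite !mem_filter m1 m2.
  by move=> /and3P[_ p1 _] /and3P[_ q2 _]; apply: s12.
rewrite mem_cat !mem_filter m1 m2 Es mem_cat.
case xp : (exposed s p) => /=; rewrite ?andbF ?andbT //.
by rewrite (exposed_sub sub1 xp) (exposed_sub sub2 xp) !andbT.
Qed.

(** * Ranks by x-coordinate *)

Definition left_of v : pred (point R) := fun q => q.1 < v.1.

(** Rank is position in the sorted list of the distinct abscissas. By the last clause the test for
    rank [m] succeeds at one index only, so a sum over all indices can find it. *)
Lemma ex_select (x0 : point R) s m :
  distinct_x s -> (m < size s)%N ->
  exists k, [/\ (k < size s)%N, count (left_of (nth x0 s k)) s = m &
    forall i, (i < size s)%N -> (count (left_of (nth x0 s i)) s == m) = (i == k)].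
Proof.
rewrite /distinct_x; set xs := map _ s => uxs ms.
pose t := sort <=%O xs.
have pt : perm_eq t xs by rewrite perm_sort.
have st : size t = size s by rewrite (perm_size pt) size_map.
have ut : uniq t by rewrite (perm_uniq pt).
have lt_t : sorted <%O t by rewrite lt_sorted_uniq_le ut sort_le_sorted.
have cE v : v \in s -> count (left_of v) s = index v.1 t.
  move=> vs; have -> : count (left_of v) s = count (< v.1)%O xs by rewrite count_map.
  have vt : v.1 \in t by rewrite (perm_mem pt) map_f.
  rewrite -(permP pt) -{1}(nth_index 0 vt); apply: count_lt_nth => //.
  by rewrite index_mem.
pose y := nth 0 t m.
have yx : y \in xs by rewrite -(perm_mem pt) mem_nth ?st.
have ks : (index y xs < size s)%N by rewrite -(size_map (fun p => p.1)) index_mem.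
have uE i : (i < size s)%N -> (count (left_of (nth x0 s i)) s == m) = (i == index y xs).
  move=> Hi; rewrite cE ?mem_nth // -(nth_map _ 0) //.
  have it : nth 0 xs i \in t by rewrite (perm_mem pt) mem_nth ?size_map.
  apply/eqP/eqP => [E|->]; last by rewrite nth_index // index_uniq ?st.
  by rewrite /y -E nth_index // index_uniq ?size_map.
by exists (index y xs); split=> //; apply/eqP; rewrite uE.
Qed.

(** * Supporting lines and convex combinations *)

Lemma ex_between (A B : seq R) :
  {in A & B, forall a b, b <= a} ->
  exists m, {in A, forall a, m <= a} /\ {in B, forall b, b <= m}.
Proof.
elim: A => [|a A IH] H.
  (* The witness is the maximum of [B] and 0, later lowered to each element of [A], all of which
     bound [B] from above. *)
  elim: B {H} => [|b B [m [_ Hm]]]; first by exists 0.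
  exists (Num.max b m); split=> // x; rewrite inE le_max.
  by case/orP => [/eqP->|/Hm->]; rewrite ?lexx ?orbT.
case: IH => [x y xA yB|m [H1 H2]]; first by apply: H; rewrite // inE xA orbT.
exists (Num.min a m); split=> x; rewrite ?inE ?le_min ?ge_min.
  by case/orP => [/eqP->|/H1->]; rewrite ?lexx ?orbT.
by move=> xB; rewrite H2 // andbT; apply: H; rewrite // inE eqxx.
Qed.

Lemma distinct_x_inj s p q : distinct_x s -> p \in s -> q \in s -> p.1 = q.1 -> p = q.
Proof.
move=> us ps qs E; rewrite -(nth_index p ps) -(nth_index p qs); congr nth.
move: us; rewrite /distinct_x => /(uniqP 0); apply; rewrite ?inE ?size_map ?index_mem //.
by rewrite !(nth_map p) ?index_mem // !nth_index.
Qed.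

(** Since [p] is below no segment, slopes towards points on its left are at least those towards
    points on its right; any slope in between will do. *)
Lemma supporting_line s p :
  distinct_x s -> p \in s -> exposed s p ->
  exists m, {in s, forall q, q.2 <= p.2 + m * (q.1 - p.1)}.
Proof.
move=> us ps /exposedP ex.
case: (@ex_between [seq (p.2 - q.2) / (p.1 - q.1) | q <- s & q.1 < p.1]
                   [seq (q.2 - p.2) / (q.1 - p.1) | q <- s & p.1 < q.1]).
  move=> _ _ /mapP[q + ->] /mapP[r + ->]; rewrite !mem_filter.
  move=> /andP[qp qs] /andP[pr rs]; have := ex q r qs rs.
  rewrite /below qp pr /= -leNgt /orient => o.
  rewrite ler_pdivrMr ?subr_gt0 // mulrAC ler_pdivlMr ?subr_gt0 //; nra.
move=> m [H1 H2]; exists m => q qs; case: (ltgtP q.1 p.1) => c.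
- have /H1 : (p.2 - q.2) / (p.1 - q.1) \in [seq (p.2 - q.2) / (p.1 - q.1) | q <- s & q.1 < p.1].
    by apply/mapP; exists q; rewrite // mem_filter c qs.
  by rewrite ler_pdivlMr ?subr_gt0 //; nra.
- have /H2 : (q.2 - p.2) / (q.1 - p.1) \in [seq (q.2 - p.2) / (q.1 - p.1) | q <- s & p.1 < q.1].
    by apply/mapP; exists q; rewrite // mem_filter c qs.
  by rewrite ler_pdivrMr ?subr_gt0 //; nra.
- by rewrite (distinct_x_inj us qs ps c) subrr mulr0 addr0.
Qed.

Lemma convex_hull_segment s q r (a b : R) :
  q \in s -> r \in s -> 0 <= a -> 0 <= b -> a + b = 1 ->
  convex_hull s (a * q.1 + b * r.1, a * q.2 + b * r.2).
Proof.
move=> qs rs a0 b0 ab.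
(* The two indicator terms add up when [q] and [r] coincide, which therefore is no special case. *)
pose w (i : 'I_(size s)) := a * (i == index q s :> nat)%:R + b * (i == index r s :> nat)%:R.
have wE (F : point R -> R) : \sum_i w i * F (nth (0, 0) s i) = a * F q + b * F r.
  under eq_bigr do rewrite mulrDl.
  have single c x : x \in s ->
      \sum_(i < size s) c * (i == index x s :> nat)%:R * F (nth (0, 0) s i) = c * F x.
    move=> xs; have xi : (index x s < size s)%N by rewrite index_mem.
    rewrite (bigD1 (Ordinal xi)) //= eqxx mulr1 nth_index // big1 ?addr0 // => i.
    by rewrite -val_eqE /= => /negPf->; rewrite mulr0 mul0r.
  by rewrite big_split /= !single.
exists w; split=> [i|||]; rewrite ?wE //.
  by rewrite addr_ge0 // mulr_ge0 // ler0n.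
by under eq_bigr do rewrite -[w _]mulr1; rewrite (wE (fun=> 1)) !mulr1.
Qed.

(** If [p] is below a segment, the segment contains a hull point above [p]; conversely, a supporting
    line bounds all convex combinations. *)
Lemma upper_hull_pointE s p :
  distinct_x s -> upper_hull_point s p <-> p \in s /\ exposed s p.
Proof.
move=> us; split=> [[ps H]|[ps ex]]; split=> //.
  apply/exposedP => q r qs rs; apply/negP => /and3P[qp pr o].
  have qr : 0 < r.1 - q.1 by rewrite subr_gt0 (lt_trans qp).
  have nz : r.1 - q.1 != 0 by rewrite gt_eqF.
  have a0 : 0 <= (r.1 - p.1) / (r.1 - q.1) by rewrite divr_ge0 // ltW // subr_gt0.
  have b0 : 0 <= (p.1 - q.1) / (r.1 - q.1) by rewrite divr_ge0 // ltW // subr_gt0.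
  have := H _ (convex_hull_segment (a := (r.1 - p.1) / (r.1 - q.1))
    (b := (p.1 - q.1) / (r.1 - q.1)) qs rs a0 b0 _) => /=.
  have -> : (r.1 - p.1) / (r.1 - q.1) * q.1 + (p.1 - q.1) / (r.1 - q.1) * r.1 = p.1 by field.
  have e1 : (r.1 - p.1) / (r.1 - q.1) + (p.1 - q.1) / (r.1 - q.1) = 1 by field.
  move=> /(_ e1 erefl).
  rewrite leNgt => /negP; apply; rewrite -subr_gt0.
  have -> : (r.1 - p.1) / (r.1 - q.1) * q.2 + (p.1 - q.1) / (r.1 - q.1) * r.2 - p.2
      = orient q p r / (r.1 - q.1) by rewrite /orient; field.
  by rewrite divr_gt0.
have [m Hm] := supporting_line us ps ex.
move=> z [w [w0 w1 z1 z2]] zp; rewrite z2.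
(* The bound is affine and the weights sum to 1, so its average is its value at [z.1 = p.1], namely
   [p.2]. *)
apply: (@le_trans _ _ (\sum_i w i * (p.2 + m * ((nth (0, 0) s i).1 - p.1)))).
  by apply: ler_sum => i _; rewrite ler_wpM2l // Hm // mem_nth.
rewrite (eq_bigr (fun i => w i * (p.2 - m * p.1) + m * (w i * (nth (0, 0) s i).1)));
  last by move=> i _; ring.
by rewrite big_split /= -mulr_suml -mulr_sumr w1 -z1 zp mul1r subrK.
Qed.

End Exposed.

(** * The program *)

Notation N0 := (Defs.Num 0).

(** Cells 2, 3 and 4 hold p, q and r; the product of truth values is a conjunction. *)
Definition below_body : cmd :=
  Seq (Read (Defs.Num 4) (cell 0))
      (Assign N0 (Arith Mul (Arith Mul (XLess (cell 3) (cell 2)) (XLess (cell 2) (cell 4)))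
                            (LeftTurn (cell 3) (cell 2) (cell 4)))).

Definition segments_body : cmd :=
  Seq (Read (Defs.Num 5) (cell 0))
      (Call N0 1 [:: cell 2; cell 3; cell 4; cell 5]).

Definition exposed_body : cmd :=
  Seq (Read (Defs.Num 4) (cell 0))
  (Seq (Call N0 2 [:: cell 2; cell 3; cell 2; cell 3; cell 4])
       (Assign N0 (Arith Eq (cell 0) N0))).

Definition left_body : cmd :=
  Seq (Read (Defs.Num 3) (cell 0)) (Assign N0 (XLess (cell 3) (cell 2))).

(** When a single point has the wanted rank, only its address contributes, so the sum of the loop is
    a search. *)
Definition select_body : cmd :=
  Seq (Read (Defs.Num 5) (cell 0))
  (Seq (Call (Defs.Num 6) 4 [:: cell 2; cell 3; cell 5])
       (Assign N0 (Arith Mul (Arith Eq (cell 6) (cell 4)) (cell 0)))).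

Definition swap_body : cmd :=
  Seq (Read (Defs.Num 3) (cell 0))
  (Seq (Read (Defs.Num 4) (Arith Defs.Sub (cell 2) (cell 0)))
  (Seq (Write (cell 0) (cell 4))
  (Seq (Write (Arith Defs.Sub (cell 2) (cell 0)) (cell 3))
       (Assign N0 N0)))).

Definition reverse_proc : cmd :=
  Call N0 6 [:: cell 0; Arith Div (cell 1) (Defs.Num 2);
                Arith Defs.Sub (Arith Defs.Add (Arith Defs.Add (cell 0) (cell 0)) (cell 1))
                      (Defs.Num 1)].

Definition rotate_proc : cmd :=
  Seq (Call (Defs.Num 3) 7 [:: cell 0; cell 1])
  (Seq (Call (Defs.Num 3) 7 [:: Arith Defs.Add (cell 0) (cell 1); cell 2])
       (Call (Defs.Num 3) 7 [:: cell 0; Arith Defs.Add (cell 1) (cell 2)])).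

Notation half := (Arith Div (cell 1) (Defs.Num 2)).

(** Cells 3 and 4 hold the numbers of points left of the pivot in the two halves. The rotation
    exchanges the other points of the first half with the left points of the second. *)
Definition partition_proc : cmd :=
  If (Arith Le (cell 1) (Defs.Num 1))
     (If (Arith Eq (cell 1) N0) (Assign N0 N0)
         (Seq (Read (Defs.Num 3) (cell 0)) (Assign N0 (XLess (cell 3) (cell 2)))))
     (Seq (Fork (Defs.Num 3) 9 [:: cell 0; half; cell 2]
                (Defs.Num 4) 9 [:: Arith Defs.Add (cell 0) half;
                                   Arith Defs.Sub (cell 1) half; cell 2])
     (Seq (Call (Defs.Num 5) 8 [:: Arith Defs.Add (cell 0) (cell 3);
                                   Arith Defs.Sub half (cell 3); cell 4])
          (Assign N0 (Arith Defs.Add (cell 3) (cell 4))))).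

(* Cells 0 to 3 hold lo, n and the numbers of hull points of the two halves. *)
Definition merge_cmd : cmd :=
  Seq (Call (Defs.Num 4) 3 [:: cell 0; cell 2; cell 0; cell 1])
  (Seq (Call (Defs.Num 5) 3 [:: Arith Defs.Add (cell 0) half; cell 3; cell 0; cell 1])
  (Seq (Call (Defs.Num 6) 8 [:: Arith Defs.Add (cell 0) (cell 4);
                               Arith Defs.Sub (Arith Defs.Add half (cell 3))
                                         (Arith Defs.Add (cell 4) (cell 5));
                               cell 5])
       (Assign N0 (Arith Defs.Add (cell 4) (cell 5))))).

Definition hull_proc : cmd :=
  If (Arith Le (cell 1) (Defs.Num 1)) (Assign N0 (cell 1))
  (Seq (Call (Defs.Num 2) 5 [:: cell 0; cell 1; cell 0; cell 1; half])
  (Seq (Read (Defs.Num 2) (cell 2))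
  (Seq (Call (Defs.Num 2) 9 [:: cell 0; cell 1; cell 2])
  (Seq (Fork (Defs.Num 2) 10 [:: cell 0; half]
             (Defs.Num 3) 10 [:: Arith Defs.Add (cell 0) half; Arith Defs.Sub (cell 1) half])
       merge_cmd)))).

(* Parameters of the procedures, by position; those of a loop start with the
   first address and the number of iterations, and [b, n] is an array.
   0 main(n); 1 number of r with p below q r (p, q); 2 number of pairs q r with p
   below q r (b, n, p); 3 number of exposed points relative to an array (b, n);
   4 number of points to the left of v (v); 5 address of the point with r points
   to its left (b, n, r); 6 exchange of addresses i and s - i (s);
   7 reverse(lo, n); 8 rotate(lo, length of first block, length of second block);
   9 partition(lo, n, v); 10 hull(lo, n). *)
Definition hull_program : program :=
  [:: Call N0 10 [:: N0; cell 0];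
      par_for 1 2 below_body; par_for 2 3 segments_body;
      par_for 3 2 exposed_body; par_for 4 1 left_body; par_for 5 3 select_body;
      par_for 6 1 swap_body; reverse_proc; rotate_proc; partition_proc;
      hull_proc].

(** * Verification of the procedures *)

Section Specs.
Variables (R : realFieldType) (W N : nat).
Notation val := (Defs.val R).
Notation P := hull_program.
Notation wp := (wp W P).
Notation proc f := (nth Skip P f).
Implicit Types (h : shared R) (s : seq (point R)) (p q v : point R).

Notation origin := ((0, 0)%R : point R).

(** Blocks lie below address [N]. The bounds cover the numerals of the program, the numbers of
    pairs, and sums of addresses such as [lo + lo + n] in a reversal. *)
Hypotheses (W64 : 64 <= W) (NW : N * N < W) (N4 : 4 * N + 4 < W).

Definition points_at h lo s : Prop :=
  forall i, i < size s -> h (lo + i) = Pt (nth origin s i).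

Definition within lo n : nat -> Prop := fun k => lo <= k < lo + n.

Lemma points_at_eq h h' lo s :
  points_at h lo s -> (forall k, within lo (size s) k -> h' k = h k) ->
  points_at h' lo s.
Proof. by move=> H E i Hi; rewrite E ?H // /within; lia. Qed.

Lemma points_at_cat h lo s1 s2 :
  points_at h lo (s1 ++ s2) <-> points_at h lo s1 /\ points_at h (lo + size s1) s2.
Proof.
split=> [H|[H1 H2] i].
  split=> i Hi.
    by rewrite H ?nth_cat ?Hi // size_cat; lia.
  rewrite -addnA H ?size_cat ?ltn_add2l // nth_cat.
  by rewrite ltnNge leq_addr addKn.
rewrite size_cat nth_cat => Hi; case: ltnP => Hi1; first exact: H1.
have -> : lo + i = lo + size s1 + (i - size s1) by lia.
by apply: H2; lia.
Qed.

(** For read-only loops one address set serves all iterations, as reads do not race. *)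
Lemma wp_for f e body (env : seq val) h lo n (F : nat -> nat) A ks kt L :
  f < size P -> proc f = par_for f e body -> size env = e -> e <= 4 ->
  (forall i, i < n ->
     wp body [:: Int R (lo + i), Int R 1 & env] h true A ks kt
        (fun m' _ => head (Int R 0) m' = Int R (F i))) ->
  n <= 2 ^ L -> lo + n <= N -> \sum_(i < n) F i < W -> 33 <= kt ->
  wp (proc f) [:: Int R lo, Int R n & env] h true A
     (100 * L.+1 + ks) (40 * L + kt)
     (fun m' _ => head (Int R 0) m' = Int R (\sum_(i < n) F i)).
Proof.
move=> fP Pf ee e4 Hb Hn HN HF Ht.
have ES : \sum_(lo <= i < lo + n) F (i - lo) = \sum_(i < n) F i.
  rewrite -{1}[lo]add0n big_addn addKn big_mkord.
  by apply: eq_bigr => i _; rewrite addnK.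
rewrite -ES in HF *.
apply: wp_conseq; first apply: (@wp_par_for R W P f e body env h true (fun _ => A) h
  (fun i => F (i - lo)) ks kt L lo n fP Pf ee e4); rewrite ?ES //; try lia.
- move=> i Hi; have [Hj ->] : i - lo < n /\ i = lo + (i - lo) by lia.
  apply: (wp_conseq (wp_framed (Hb _ Hj))) => // m' h' [H1 _ H2].
  by rewrite addKn; split=> // k _; apply: H2.
- by move=> k [].
- by move=> m' h' [].
Qed.

Lemma sum_nth (F : point R -> nat) s :
  \sum_(i < size s) F (nth origin s i) = \sum_(x <- s) F x.
Proof. by rewrite [RHS](big_nth origin) big_mkord. Qed.

Lemma sum_bool (a : pred (point R)) s : \sum_(x <- s) (a x : nat) = count a s.
Proof. by rewrite -sum1_count [RHS]big_mkcond. Qed.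

Lemma below_spec h b s p q L :
  points_at h b s -> b + size s <= N -> size s <= 2 ^ L ->
  wp (proc 1) [:: Int R b; Int R (size s); Pt p; Pt q] h true (within b (size s))
     (200 * L.+1) (100 * L.+1)
     (fun m' _ => head (Int R 0) m' = Int R (count (below p q) s)).
Proof.
move=> Hs HN HL.
apply: wp_conseq; first apply: (@wp_for 1 2 below_body [:: Pt p; Pt q] h b (size s)
  (fun i => below p q (nth origin s i)) (within b (size s)) 100 33 L) => //.
- move=> i Hi; eapply wp_span; first apply: wp_seq.
    eapply wp_read; [ev|ev|rewrite /within; lia|by []|rewrite /= Hs //].
    eapply wp_assign; [ev; lia|ev; by do 3 case: (_ < _)%R => //=; lia|by []|].
    by rewrite /= !mulnb /below andbA.
  bound.
- by rewrite (sum_nth (below p q)) sum_bool; have := count_size (below p q) s; lia.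
- by [].
- by [].
- by lia.
- by lia.
- by move=> m' h' ->; rewrite (sum_nth (below p q)) sum_bool.
Qed.

Lemma segments_lt s p : size s <= N -> \sum_(q <- s) count (below p q) s < W.
Proof.
move=> sN; apply: leq_ltn_trans (_ : size s * size s < W).
  rewrite -[X in _ <= X * _]sum1_size big_distrl /=; apply: leq_sum => q _.
  by rewrite mul1n count_size.
by apply: leq_ltn_trans (leq_mul sN sN) NW.
Qed.

(** Spans of nested parallel loops add up instead of multiplying: the three nested loops cost 200,
    400 and 600 times [L.+1]. *)
Lemma segments_spec h b s p L :
  points_at h b s -> b + size s <= N -> size s <= 2 ^ L ->
  wp (proc 2) [:: Int R b; Int R (size s); Int R b; Int R (size s); Pt p] h true
     (within b (size s)) (400 * L.+1) (200 * L.+1)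
     (fun m' _ => head (Int R 0) m' = Int R (\sum_(q <- s) count (below p q) s)).
Proof.
move=> Hs HN HL.
apply: wp_conseq; first apply: (@wp_for 2 3 segments_body
  [:: Int R b; Int R (size s); Pt p] h b (size s)
  (fun i => count (below p (nth origin s i)) s) (within b (size s))
  (200 * L.+1 + 100) (100 * L.+1 + 33) L) => //.
- move=> i Hi; eapply wp_span; first apply: wp_seq.
    eapply wp_read; [ev|ev|rewrite /within; lia|rewrite /words /=; lia|rewrite /= Hs //].
    eapply wp_call; [ev|evs|by []| |by []| |].
    + by apply: (wp_conseq (below_spec p (nth origin s i) Hs HN HL)) => // m' h' ->.
    + bound.
    + by lia.
  bound.
- rewrite (sum_nth (fun q => count (below p q) s)).
  by apply: segments_lt; lia.
- by lia.
- by [].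
- by [].
- by lia.
- by lia.
- by move=> m' h' ->; rewrite (sum_nth (fun q => count (below p q) s)).
Qed.

Lemma exposed_sum s p : (\sum_(q <- s) count (below p q) s == 0) = exposed s p.
Proof.
rewrite sum_nat_seq_eq0 /exposed -all_predC; apply: eq_all => q /=.
by rewrite has_count lt0n negbK.
Qed.

Lemma exposed_spec h b s lo t L :
  points_at h b s -> b + size s <= N -> size s <= 2 ^ L ->
  points_at h lo t -> b <= lo -> lo + size t <= b + size s -> size t <= 2 ^ L ->
  wp (proc 3) [:: Int R lo; Int R (size t); Int R b; Int R (size s)] h true
     (within b (size s)) (600 * L.+1) (300 * L.+1)
     (fun m' _ => head (Int R 0) m' = Int R (count (exposed s) t)).
Proof.
move=> Hs HN HL Ht l1 l2 HLt.
have SW p : \sum_(q <- s) count (below p q) s < W by apply: segments_lt; lia.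
apply: wp_conseq; first apply: (@wp_for 3 2 exposed_body
  [:: Int R b; Int R (size s)] h lo (size t)
  (fun i => exposed s (nth origin t i)) (within b (size s))
  (400 * L.+1 + 100) (200 * L.+1 + 33) L) => //.
- move=> i Hi; eapply wp_span; first apply: wp_seq.
    eapply wp_read; [ev|ev|rewrite /within; lia|bound|rewrite /= Ht //].
    apply: wp_seq; eapply wp_call; [ev|evs|by []| |by []| |].
    + apply: (wp_conseq (segments_spec (nth origin t i) Hs HN HL)) => // m' h' -> /=.
      eapply wp_assign; [ev|ev|bound|].
      by rewrite /= exposed_sum.
    + bound.
    + by lia.
  bound.
- by lia.
- by rewrite (sum_nth (exposed s)) sum_bool; have := count_size (exposed s) t; lia.
- by lia.
- by [].
- by [].
- by lia.
- by lia.
- by move=> m' h' ->; rewrite (sum_nth (exposed s)) sum_bool.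
Qed.

Lemma left_spec h b s v L :
  points_at h b s -> b + size s <= N -> size s <= 2 ^ L ->
  wp (proc 4) [:: Int R b; Int R (size s); Pt v] h true (within b (size s))
     (200 * L.+1) (100 * L.+1)
     (fun m' _ => head (Int R 0) m' = Int R (count (left_of v) s)).
Proof.
move=> Hs HN HL.
apply: wp_conseq; first apply: (@wp_for 4 1 left_body [:: Pt v] h b (size s)
  (fun i => left_of v (nth origin s i)) (within b (size s)) 100 33 L) => //.
- move=> i Hi; eapply wp_span; first apply: wp_seq.
    eapply wp_read; [ev|ev|rewrite /within; lia|by []|rewrite /= Hs //].
    by eapply wp_assign; [ev|ev|by []|].
  bound.
- by rewrite (sum_nth (left_of v)) sum_bool; have := count_size (left_of v) s; lia.
- by [].
- by [].
- by lia.
- by lia.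
- by move=> m' h' ->; rewrite (sum_nth (left_of v)) sum_bool.
Qed.

Lemma select_spec h b s r k L :
  points_at h b s -> b + size s <= N -> size s <= 2 ^ L -> k < size s -> r <= N ->
  (forall i, i < size s -> (count (left_of (nth origin s i)) s == r) = (i == k)) ->
  wp (proc 5) [:: Int R b; Int R (size s); Int R b; Int R (size s); Int R r] h true
     (within b (size s)) (400 * L.+1) (200 * L.+1)
     (fun m' _ => head (Int R 0) m' = Int R (b + k)).
Proof.
move=> Hs HN HL Hk Hr Hu.
have ES : \sum_(i < size s) (i == k :> nat) * (b + i) = b + k.
  rewrite (bigD1 (Ordinal Hk)) //= eqxx mul1n big1 ?addn0 // => i /negPf.
  by rewrite -val_eqE /= => ->.
apply: wp_conseq; first apply: (@wp_for 5 3 select_body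
  [:: Int R b; Int R (size s); Int R r] h b (size s)
  (fun i => (i == k) * (b + i)) (within b (size s))
  (200 * L.+1 + 100) (100 * L.+1 + 33) L) => //.
- move=> i Hi; eapply wp_span; first apply: wp_seq.
    eapply wp_read; [ev|ev|rewrite /within; lia|bound|rewrite /= Hs //].
    apply: wp_seq; eapply wp_call; [ev|evs|by []| |by []| |].
    + apply: (wp_conseq (left_spec (nth origin s i) Hs HN HL)) => // m' h' -> /=.
      rewrite -(Hu i Hi); eapply wp_assign; [ev|ev|bound|by []].
    + bound.
    + by lia.
  bound.
- by rewrite ES; lia.
- by lia.
- by [].
- by [].
- by lia.
- by lia.
- by move=> m' h' ->; rewrite ES.
Qed.

(** * Procedures that move points *)

Lemma swap_spec h lo n L :
  lo + n <= N -> n <= 2 ^ L ->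
  wp (proc 6) [:: Int R lo; Int R (n %/ 2); Int R (lo + lo + n - 1)] h false
     (within lo n) (200 * L.+1) (100 * L.+1)
     (fun _ h' => forall k, within lo n k -> h' k = h (lo + lo + n - 1 - k)).
Proof.
move=> HN HL.
(* Disjointness is required for arbitrary indices, hence the range inside [A]: otherwise [i] and its
   mirror image would share addresses. *)
pose A i k := lo <= i < lo + n %/ 2 /\ (k = i \/ k = lo + lo + n - 1 - i).
apply: wp_conseq; first apply: wp_framed;
  first apply: (@wp_par_for R W P 6 1 swap_body [:: Int R (lo + lo + n - 1)] h
  false A (fun k => h (lo + lo + n - 1 - k)) (fun=> 0) 100 33 L lo (n %/ 2)) => //.
- move=> i Hi; eapply wp_span; first apply: wp_seq.
    eapply wp_read; [ev|ev|by split => //; left|bound|rewrite /=].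
    apply: wp_seq; eapply wp_read; [ev|ev|by split => //; right|bound|rewrite /=].
    apply: wp_seq; eapply wp_write; [ev|ev|by split => //; left|bound|rewrite /=].
    apply: wp_seq; eapply wp_write; [ev|ev|by split => //; right|bound|rewrite /=].
    eapply wp_assign; [ev|ev|bound|split => //= k [_ Hk]].
    rewrite /upd; case: eqP => [->|Hk1]; first by congr h; lia.
    by case: Hk => [->|//]; rewrite eqxx.
  bound.
- by right => i j k [Hi H1] [Hj H2]; lia.
- by lia.
- by lia.
- by lia.
- by rewrite big1 //; lia.
- by [].
- by move=> k [i Hi [_ Hk]]; rewrite /within; lia.
- by lia.
- by lia.
- move=> m' h' [[_ H1] H2 _] k Hk.
  have [k1|k1] := ltnP k (lo + n %/ 2).
    by apply: H1; exists k; rewrite /A; move: Hk; rewrite /within; lia.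
  (* For odd [n] the middle address is touched by no iteration and is its own mirror image. *)
  have [k2|k2] := ltnP k (lo + (n - n %/ 2)).
    rewrite H2; last by move=> [i Hi [_ Hk']]; move: Hk; rewrite /within; lia.
    by congr h; move: Hk; rewrite /within; lia.
  apply: H1; exists (lo + lo + n - 1 - k); rewrite /A; move: Hk; rewrite /within; lia.
Qed.

Lemma reverse_spec h lo s L :
  points_at h lo s -> lo + size s <= N -> size s <= 2 ^ L ->
  wp (proc 7) [:: Int R lo; Int R (size s)] h false (within lo (size s))
     (300 * L.+1) (200 * L.+1) (fun _ h' => points_at h' lo (rev s)).
Proof.
move=> Hs HN HL; eapply wp_span.
  eapply wp_call; [ev|evs|by []| |by []| |].
  + apply: (wp_conseq (swap_spec h HN HL)) => // m' h' H i.
    rewrite size_rev => Hi; rewrite H /within; last by lia.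
    rewrite nth_rev // -Hs; last by lia.
    by congr h; lia.
  + bound.
  + by lia.
bound.
Qed.

Lemma rotate_spec h lo x y L :
  points_at h lo (x ++ y) -> lo + (size x + size y) <= N ->
  size x + size y <= 2 ^ L ->
  wp (proc 8) [:: Int R lo; Int R (size x); Int R (size y)] h false
     (within lo (size x + size y))
     (1400 * L.+1) (300 * L.+1) (fun _ h' => points_at h' lo (y ++ x)).
Proof.
move=> /points_at_cat[Hx Hy] HN HL; eapply wp_span.
  apply: wp_seq; eapply wp_call; [ev|evs|by []| |by []| |].
  + apply: (wp_conseq (wp_framed (@reverse_spec _ _ _ L Hx _ _))) => //; try lia.
      by move=> k; rewrite /within; lia.
    move=> m1 h1 [Hx1 F1 _].
    have {F1}Hy1 : points_at h1 (lo + size x) y.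
      by apply: points_at_eq Hy _ => k; rewrite /within => Hk; apply: F1; rewrite /within; lia.
    apply: wp_seq; eapply wp_call; [ev|evs|by []| |by []| |].
    - apply: (wp_conseq (wp_framed (@reverse_spec _ _ _ L Hy1 _ _))) => //; try lia.
        by move=> k; rewrite /within; lia.
      move=> m2 h2 [Hy2 F2 _].
      have {F2}Hx2 : points_at h2 lo (rev x).
        apply: points_at_eq Hx1 _ => k; rewrite size_rev /within => Hk; apply: F2.
        by rewrite /within; lia.
      have H2 : points_at h2 lo (rev x ++ rev y).
        by apply/points_at_cat; rewrite size_rev.
      eapply wp_call; [ev|evs|by []| |by []| |].
      * have := @reverse_spec h2 lo (rev x ++ rev y) L H2.
        rewrite size_cat !size_rev => /(_ HN HL) H.
        by apply: (wp_conseq H) => // m3 h3; rewrite rev_cat !revK.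
      * bound.
      * by lia.
    - bound.
    - by lia.
  + bound.
  + by lia.
bound.
Qed.

Lemma partition_small h lo s v :
  points_at h lo s -> lo + size s <= N -> size s <= 1 ->
  wp (proc 9) [:: Int R lo; Int R (size s); Pt v] h false (within lo (size s))
     100 33
     (fun m' h' => head (Int R 0) m' = Int R (count (left_of v) s) /\
        points_at h' lo (filter (left_of v) s ++ filter (predC (left_of v)) s)).
Proof.
case: s => [|p [|//]] Hs HN _.
  eapply wp_span; first eapply wp_if; [ev|bound|rewrite /=|].
    eapply wp_if; [ev|bound|rewrite /=].
    by eapply wp_assign; [ev|ev|bound|].
  bound.
eapply wp_span; first eapply wp_if; [ev|bound|rewrite /=|].
  eapply wp_if; [ev|bound|rewrite /=].
  apply: wp_seq; have hp : h lo = Pt p by rewrite -[lo]addn0 Hs.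
  eapply wp_read; [ev|ev|rewrite /within /=; lia|bound|rewrite /= hp].
  eapply wp_assign; [ev|ev|bound|rewrite /= addn0; split=> //].
  by case: (left_of v p).
bound.
Qed.

(** Each level adds one rotation, whose span is linear in [L], whence the square. *)
Lemma partition_spec h lo s v L :
  points_at h lo s -> lo + size s <= N -> size s <= 2 ^ L ->
  wp (proc 9) [:: Int R lo; Int R (size s); Pt v] h false (within lo (size s))
     (3000 * (L.+1 * L.+1)) (400 * L.+1)
     (fun m' h' => head (Int R 0) m' = Int R (count (left_of v) s) /\
        points_at h' lo (filter (left_of v) s ++ filter (predC (left_of v)) s)).
Proof.
elim: L h lo s => [|L IH] h lo s Hs HN HL.
  by apply: (wp_conseq (partition_small v Hs HN _)) => //; lia.
have [n1|n1] := leqP (size s) 1.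
  by apply: (wp_conseq (partition_small v Hs HN n1)) => //; lia.
rewrite expnS in HL; set c := size s %/ 2.
pose s1 := take c s; pose s2 := drop c s.
have z1 : size s1 = c by rewrite size_take; case: ifP; lia.
have z2 : size s2 = size s - c by rewrite size_drop.
have es : s = s1 ++ s2 by rewrite cat_take_drop.
have [Hs1 Hs2] : points_at h lo s1 /\ points_at h (lo + c) s2.
  by rewrite -z1; apply/points_at_cat; rewrite -es.
have I1 := IH h lo s1 Hs1 ltac:(lia) ltac:(lia).
have I2 := IH h (lo + c) s2 Hs2 ltac:(lia) ltac:(lia).
have HF1 := count_size (left_of v) s1.
have HF2 := count_size (left_of v) s2.
pose a := left_of v; rewrite z1 in I1; rewrite z2 in I2.
eapply wp_span; first eapply wp_if; [ev|bound| |].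
  have -> : (arith_sem Le (size s) 1 : nat) = 0 by rewrite /=; lia.
  rewrite /=; apply: wp_seq.
  eapply wp_fork; [ev|evs|by []|ev|evs|by []|exact: I1|exact: I2| | | | | | |].
  - by move=> k; rewrite /within /c; lia.
  - by move=> k; rewrite /within /c; lia.
  - by right=> k; rewrite /within /c; lia.
  - by [].
  - by rewrite /words /=; lia.
  - by lia.
  move=> mf hf mg hg h' [-> Hf] [-> Hg] F1 F2 F3 /=; rewrite -/a in Hf Hg *.
  have {Hf}Hf : points_at h' lo (filter a s1 ++ filter (predC a) s1).
    apply: points_at_eq Hf _ => k Hk; apply: F1; move: Hk.
    by rewrite size_cat !size_filter count_predC z1.
  have {Hg}Hg : points_at h' (lo + c) (filter a s2 ++ filter (predC a) s2).
    apply: points_at_eq Hg _ => k Hk; apply: F2; move: Hk.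
    by rewrite size_cat !size_filter count_predC z2.
  have C1 := count_predC a s1; have C2 := count_predC a s2.
  move/points_at_cat: Hf => [Hf1 Hf2]; move/points_at_cat: Hg => [Hg1 Hg2].
  have Hmid : points_at h' (lo + count a s1) (filter (predC a) s1 ++ filter a s2).
    apply/points_at_cat; rewrite !size_filter in Hf2 *; split=> //.
    by have -> : lo + count a s1 + count (predC a) s1 = lo + c by lia.
  have Hr := @rotate_spec h' (lo + count a s1) (filter (predC a) s1) (filter a s2)
    L.+1 Hmid.
  rewrite !size_filter expnS in Hr.
  have {}Hr := Hr ltac:(lia) ltac:(lia).
  (* The length passed to the rotation is put into the form that the program computes. *)
  have Ec : count (predC a) s1 = c - count a s1 by lia.
  rewrite {1}Ec in Hr.
  apply: wp_seq; eapply wp_call; [ev; rewrite /= -/c -/a; lia|evs|by []| |by []| |].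
  - apply: (wp_conseq (wp_framed Hr)) => //.
      by move=> k; rewrite /within; lia.
    move=> m2 h2 [/points_at_cat[R1 R2] F _] /=.
    eapply wp_assign; [ev|ev|bound|].
    rewrite /= es count_cat !filter_cat -!catA; split=> //.
    apply/points_at_cat; split.
      apply: points_at_eq Hf1 _ => k; rewrite size_filter /within => Hk.
      by apply: F; rewrite /within; lia.
    rewrite size_filter; apply/points_at_cat; split=> //.
    apply/points_at_cat; split=> //.
    have -> : lo + count a s1 + size (filter a s2) + size (filter (predC a) s1)
       = lo + c + size (filter a s2) by rewrite !size_filter; lia.
    apply: points_at_eq Hg2 _ => k; rewrite !size_filter /within => Hk.
    by apply: F; rewrite /within; lia.
  - by rewrite /words /=; lia.
  - by lia.
clear; rewrite /ops_seq /=; nia.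
Qed.

Lemma is_hull_small s : size s <= 1 -> is_hull s s.
Proof.
case: s => [|p [|//]] _; split=> // q; rewrite ?inE //.
case: eqP => // ->; apply/esym/exposedP => r t; rewrite !inE => /eqP-> /eqP->.
by rewrite /below ltxx.
Qed.

Lemma hull_small h lo s :
  points_at h lo s -> lo + size s <= N -> size s <= 1 ->
  wp (proc 10) [:: Int R lo; Int R (size s)] h false (within lo (size s)) 100 33
     (fun m' h' => exists H r, [/\ head (Int R 0) m' = Int R (size H),
        points_at h' lo (H ++ r), perm_eq (H ++ r) s & is_hull s H]).
Proof.
move=> Hs HN s1; eapply wp_span; first eapply wp_if; [ev|bound| |].
  have -> : (arith_sem Le (size s) 1 : nat) = 1 by rewrite /= s1.
  eapply wp_assign; [ev|ev|bound|].
  by exists s, [::]; split; rewrite ?cats0 //; apply: is_hull_small.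
bound.
Qed.

Lemma merge_spec h lo s s1 s2 H1 r1 H2 r2 L :
  {in s1 & s2, forall p q, p.1 < q.1}%R -> is_hull s1 H1 -> is_hull s2 H2 ->
  s =i s1 ++ s2 -> perm_eq ((H1 ++ r1) ++ (H2 ++ r2)) s ->
  size (H1 ++ r1) = size s %/ 2 -> points_at h lo ((H1 ++ r1) ++ (H2 ++ r2)) ->
  lo + size s <= N -> size s <= 2 ^ L ->
  wp merge_cmd [:: Int R lo; Int R (size s); Int R (size H1); Int R (size H2)] h
     false (within lo (size s)) (3000 * L.+1) (400 * L.+1)
     (fun m' h' => exists H r, [/\ head (Int R 0) m' = Int R (size H),
        points_at h' lo (H ++ r), perm_eq (H ++ r) s & is_hull s H]).
Proof.
move=> s12 hull1 hull2 es; set S := _ ++ _ => pS zc XS HN HL.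
have zS : size S = size s by rewrite (perm_size pS).
(* Exposure depends on the set of points only, so the permuted array can be used to decide it. *)
have exS : exposed S =1 exposed s.
  by move=> p; apply/idP/idP; apply: exposed_sub => q; rewrite (perm_mem pS).
pose i := count (exposed s) H1; pose j := count (exposed s) H2.
(* [A1] and [A2] survive from the two hulls and [B] is all that separates them; rotating [B ++ A2]
   makes the survivors contiguous. *)
have [A1 [B [A2 [eS zA1 zA2 hull]]]] : exists A1 B A2, [/\ S = A1 ++ (B ++ A2) ++ r2,
    size A1 = i, size A2 = j & is_hull s (A1 ++ A2)].
  exists (take i H1), (drop i H1 ++ r1 ++ take (size H2 - j) H2),
    (drop (size H2 - j) H2); split.
  - rewrite -!catA (catA _ (drop _ H2)) cat_take_drop (catA _ (drop _ H1)).
    by rewrite cat_take_drop /S -!catA.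
  - by rewrite size_takel // count_size.
  - by rewrite size_drop subKn // count_size.
  - exact: (is_hull_merge s12).
have rS : perm_eq ((A1 ++ A2) ++ (B ++ r2)) s.
  apply: perm_trans pS; rewrite eS -!catA perm_cat2l !catA perm_cat2r.
  by rewrite perm_catC.
have li : i <= size H1 := count_size _ _.
have lj : j <= size H2 := count_size _ _.
have C1 h' (X : points_at h' lo S) : wp (proc 3)
     [:: Int R lo; Int R (size H1); Int R lo; Int R (size s)] h' true
     (within lo (size s)) (600 * L.+1) (300 * L.+1)
     (fun m' _ => head (Int R 0) m' = Int R i).
  have Y : points_at h' lo H1 by move: X; rewrite /S -catA => /points_at_cat[].
  have := @exposed_spec h' lo S lo H1 L X; rewrite zS (eq_count exS); apply=> //.
    by rewrite -zS /S !size_cat; lia.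
  by apply: leq_trans HL; rewrite -zS /S !size_cat; lia.
have C2 h' (X : points_at h' lo S) : wp (proc 3)
     [:: Int R (lo + size s %/ 2); Int R (size H2); Int R lo; Int R (size s)] h' true
     (within lo (size s)) (600 * L.+1) (300 * L.+1)
     (fun m' _ => head (Int R 0) m' = Int R j).
  have Y : points_at h' (lo + size s %/ 2) H2.
    by move: X => /points_at_cat[_]; rewrite zc => /points_at_cat[].
  have := @exposed_spec h' lo S (lo + size s %/ 2) H2 L X.
  rewrite zS (eq_count exS); apply=> //.
  - by lia.
  - by rewrite -zc -zS /S !size_cat; lia.
  - by apply: leq_trans HL; rewrite -zS /S !size_cat; lia.
have zB : size B = size s %/ 2 + size H2 - (i + j).
  have := congr1 size eS; rewrite /S -zc !size_cat zA1 zA2.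
  by clear -li lj; lia.
have l1 : i + (size B + j) <= size s.
  by rewrite -zS eS !size_cat zA1 zA2; clear; lia.
have l2 : size s %/ 2 + size H2 <= size s.
  by rewrite -zc -zS /S !size_cat; clear; lia.
have Hr h' (X : points_at h' (lo + i) (B ++ A2)) := @rotate_spec h' (lo + i) B A2 L X
  ltac:(clear -l1 HN zA2; lia) ltac:(clear -l1 HL zA2; lia).
rewrite zB zA2 in Hr l1.
have hc : size s %/ 2 <= size s by apply: leq_div.
clearbody i j.
clear s12 hull1 hull2 es exS pS zc zS s1 s2.
eapply wp_span.
  apply: wp_seq.
  eapply (wp_call_spec (C1 _ XS)); [ev|evs|by []|by []|by []|by []|bound|by lia|].
  move=> m4 h4 -> _ /(_ isT) E4 /=; clear C1.
  have {}XS : points_at h4 lo S by apply: points_at_eq XS _.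
  apply: wp_seq.
  eapply (wp_call_spec (C2 _ XS)); [ev|evs|by []|by []|by []|by []|bound|by lia|].
  move=> m5 h5 -> _ /(_ isT) E5 /=; clear C2.
  have {}XS : points_at h5 lo S by apply: points_at_eq XS _.
  move: XS; rewrite eS => /points_at_cat[Y1 /points_at_cat[Y2 Y3]].
  rewrite zA1 in Y2 Y3; rewrite size_cat zB zA2 in Y3.
  clear E4 E5 eS.
  apply: wp_seq.
  eapply (wp_call_spec (Hr _ Y2)); [ev|evs|by []|by []| |by []|bound|by lia|].
    by move=> x; rewrite /within; lia.
  move=> m6 h6 /points_at_cat[Z1 Z2] F _ /=; clear Hr Y2.
  eapply wp_assign; [ev|ev|bound|].
  exists (A1 ++ A2), (B ++ r2); split=> //.
    by rewrite size_cat zA1 zA2.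
  rewrite -catA; apply/points_at_cat; split.
    apply: points_at_eq Y1 _ => x; rewrite /within => Hx; apply: F.
    by rewrite /within; lia.
  rewrite zA1; apply/points_at_cat; split=> //.
  apply/points_at_cat; split=> //.
  rewrite zA2 zB -[X in points_at _ X](addnA (lo + i)) [j + _]addnC.
  apply: points_at_eq Y3 _ => x; rewrite /within => Hx; apply: F.
  by rewrite /within; lia.
(* Two counts and a rotation cost 600 + 600 + 1400 times [L.+1]; the rest of 3000 pays for the
   commands around them. *)
rewrite /ops_seq /=; lia.
Qed.

(** A level is dominated by its partition, of span quadratic in [L], whence the cube. Space stays
    linear, because the working space of a level is released before the recursion and only a frame
    is retained. *)
Lemma hull_spec h lo s L :
  distinct_x s -> points_at h lo s -> lo + size s <= N -> size s <= 2 ^ L ->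
  wp (proc 10) [:: Int R lo; Int R (size s)] h false (within lo (size s))
     (4900 * (L.+1 * L.+1 * L.+1)) (700 * L.+1)
     (fun m' h' => exists H r, [/\ head (Int R 0) m' = Int R (size H),
        points_at h' lo (H ++ r), perm_eq (H ++ r) s & is_hull s H]).
Proof.
elim: L h lo s => [|L IH] h lo s us Hs HN HL.
  by apply: (wp_conseq (hull_small Hs HN _)) => //; lia.
have [n1|n1] := leqP (size s) 1.
  by apply: (wp_conseq (hull_small Hs HN n1)) => //; lia.
set c := size s %/ 2.
(* The pivot has exactly [c] points to its left, and itself goes to the right part. *)
have [k [ks kc ku]] := @ex_select R origin s c us ltac:(rewrite /c; lia).
have Hsel := select_spec Hs HN HL ks (r := c) ltac:(rewrite /c; lia) ku.
pose v := nth origin s k; rewrite -/v in kc.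
have Hpart h' := fun Hs' => @partition_spec h' lo s v L.+1 Hs' HN HL.
rewrite kc in Hpart.
pose s1 := filter (left_of v) s; pose s2 := filter (predC (left_of v)) s.
rewrite -/s1 -/s2 in Hpart.
have z1 : size s1 = c by rewrite size_filter.
have z2 : size s2 = size s - c by rewrite size_filter -(count_predC (left_of v) s) kc addKn.
have us1 : distinct_x s1 by apply: subseq_uniq us; apply/map_subseq/filter_subseq.
have us2 : distinct_x s2 by apply: subseq_uniq us; apply/map_subseq/filter_subseq.
have ps : perm_eq (s1 ++ s2) s by apply/permPl/perm_filterC.
have s12 : {in s1 & s2, forall p q, p.1 < q.1}%R.
  move=> p q; rewrite !mem_filter /= /left_of -leNgt => /andP[pv _] /andP[vq _].
  exact: lt_le_trans pv vq.
have hc : c < size s by rewrite /c; lia.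
have L1 : c <= 2 ^ L by rewrite expnS in HL; rewrite /c; lia.
have L2 : size s - c <= 2 ^ L by rewrite expnS in HL; rewrite /c; lia.
have -> : proc 10 = hull_proc by [].
eapply wp_span; first eapply wp_if; [ev|bound| |].
  have -> : (arith_sem Le (size s) 1 : nat) = 0 by rewrite /= leqNgt n1.
  clear n1 us ku kc.
  apply: wp_seq.
  eapply (wp_call_spec Hsel); [ev|evs|by []|by []|by []|by []|bound|by lia|].
  move=> m1 h1 -> _ /(_ isT) E1 /=.
  apply: wp_seq; eapply wp_read; [ev|ev|by rewrite /within; lia|bound|].
  rewrite /= E1 Hs // -/v.
  have {}Hs : points_at h1 lo s by apply: points_at_eq Hs _ => *.
  have {}Hpart := Hpart h1 Hs.
  apply: wp_seq.
  eapply (wp_call_spec Hpart); [ev|evs|by []|by []|by []|by []|bound|by lia|].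
  move=> m2 h2 [-> /points_at_cat[P1 P2]] _ _ /=; rewrite z1 in P2.
  have := IH h2 lo s1 us1 P1; rewrite z1 => /(_ ltac:(clear -HN hc; lia) L1) I1.
  have := IH h2 (lo + c) s2 us2 P2; rewrite z2 => /(_ ltac:(clear -HN hc; lia) L2) I2.
  clear IH Hsel Hpart L1 L2 us1 us2.
  apply: wp_seq.
  eapply wp_fork; [ev|evs|by []|ev|evs|by []|exact: I1|exact: I2| | | | | | |].
  - by move=> j; rewrite /within -/c; clear -hc; lia.
  - by move=> j; rewrite /within -/c; clear -hc; lia.
  - by right=> j; rewrite /within -/c; clear -hc; lia.
  - by [].
  - by clear; rewrite /words /=; lia.
  - by clear; lia.
  move=> mf hf mg hg h3 [H1 [r1 [-> Hf p1 hull1]]] [H2 [r2 [-> Hg p2 hull2]]].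
  move=> F1 F2 _ /=.
  have q1 := perm_size p1; have q2 := perm_size p2; rewrite size_cat z1 in q1.
  rewrite size_cat z2 in q2.
  apply: wp_conseq; first apply: (merge_spec (L := L.+1) (r1 := r1) (r2 := r2) s12
    hull1 hull2) => //.
  - by move=> p; rewrite (perm_mem ps).
  - by rewrite (perm_trans _ ps) // perm_cat.
  - by rewrite size_cat.
  - apply/points_at_cat; rewrite size_cat q1; split.
      apply: points_at_eq Hf _ => j Hj; apply: F1.
      by move: Hj; rewrite size_cat q1.
    apply: points_at_eq Hg _ => j Hj; apply: F2.
    by move: Hj; rewrite size_cat q2.
  - by [].
  - by [].
  - by [].
  - by clear; lia.
  - by [].
clear; rewrite /ops_seq /=; nia.
Qed.

End Specs.

(** * Bounds in terms of the input size *)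

Section Main.
Variable R : realFieldType.
Implicit Types (s : seq (point R)).

Lemma run_det c (P : program) s r1 h1 u1 r2 h2 u2 :
  run c P s r1 h1 u1 -> run c P s r2 h2 u2 -> [/\ r1 = r2, h1 = h2 & u1 = u2].
Proof.
move=> [m1 -> [_ E1]] [m2 -> [_ E2]].
by have [-> -> ->] := exec_det E1 E2.
Qed.

Lemma run_hull s : valid_input s ->
  exists r h u, [/\ run 6 hull_program s r h u, upper_hull_output s r h,
    forall k, k \in reads u ++ writes u -> k < size s,
    Defs.span u <= 4950 * (log (size s)).+2 ^ 3
  & proc_space u <= seq_space u <= 800 * (log (size s)).+2].
Proof.
move=> [_ us]; set n := size s; set W := n.+2 ^ 6.
(* Four of the six factors are at least 2 each; the exponent 6 gives [64 <= W] even for [n = 0]. *)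
have W2 : n.+2 ^ 2 * 16 <= W.
  by rewrite /W (expnD _ 2 4) leq_mul2l (@leq_exp2r 2 n.+2 4) // orbT.
have W64 : 64 <= W by apply: leq_trans W2; rewrite -mulnn; nia.
have NW : n * n < W by apply: leq_trans W2; rewrite -mulnn; nia.
have N4 : 4 * n + 4 < W by apply: leq_trans W2; rewrite -mulnn; nia.
have HL : n <= 2 ^ (log n).+1 by apply/ltnW/trunc_log_ltn.
have Hs : points_at (input_memory s) 0 s.
  by move=> i Hi; rewrite add0n /input_memory Hi.
have H := hull_spec W64 NW N4 us Hs (leqnn _) HL.
have [m [h [u [E [_ A] l1 l2 [K [r [Em Hp ps [pw Hm]]]]]]]] :
    wp W hull_program (nth Skip hull_program 0) [:: Int R n] (input_memory s)
      false (within 0 n) (4950 * (log n).+2 ^ 3) (800 * (log n).+2)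
      (fun m' h' => exists H r, [/\ head (Int R 0) m' = Int R (size H),
        points_at h' 0 (H ++ r), perm_eq (H ++ r) s & is_hull s H]).
  eapply wp_span.
    eapply (wp_call_spec H); [ev|evs|by []|by []|by []|by []|bound|by lia|].
    by move=> mf h' [K [r [-> H2 H3 H4]]] _ _; exists K, r.
  by rewrite /ops_seq !expnS expn0; clear; rewrite /=; nia.
exists (Int R (size K)), h, u; split=> //.
- by exists m.
- exists (K ++ r), (size K); split=> //.
  + by rewrite size_cat leq_addr.
  + rewrite take_size_cat // sorted_pairwise //.
    by move=> y x z; apply: lt_trans.
  + move=> p; rewrite take_size_cat // Hm (upper_hull_pointE _ us).
    by split=> /andP.
- by rewrite l2 andbT; apply: proc_space_le_seq_space E.
Qed.

(** From [n = 2] on the logarithm is at least 1, which absorbs the additive constant and explains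
    the thresholds and factors 3 below. *)
Lemma log_bound n : 2 <= n -> (log n).+2 <= 3 * log n.
Proof. by move=> n2; have := @trunc_log_max 2 n 1 isT n2; rewrite /log; lia. Qed.

End Main.

Theorem corollary23 (R : realFieldType) :
  exists (c : nat) (P : program),
    strong_PIP c P (@valid_input R) /\ @constructs_upper_hull R c P.
Proof.
exists 6, hull_program.
(* Execution is deterministic, so what holds of the run constructed above holds of every run. *)
have det (s : seq (point R)) r h u : valid_input s -> run 6 hull_program s r h u ->
    [/\ upper_hull_output s r h, forall k, k \in reads u ++ writes u -> k < size s,
    Defs.span u <= 4950 * (log (size s)).+2 ^ 3
    & proc_space u <= seq_space u <= 800 * (log (size s)).+2].
  move=> vs E; have [r' [h' [u' [E' H1 H2 H3 H4]]]] := run_hull vs.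
  by have [-> -> ->] := run_det E E'.
have alloc (s : seq (point R)) r h u : valid_input s -> run 6 hull_program s r h u ->
    allocated (size s) u = [::].
  move=> vs E; have [_ H _ _] := det _ _ _ _ vs E.
  rewrite /allocated; set f := filter _ _; suff -> : f = [::] by [].
  by apply/eqP; rewrite -(negbK (_ == _)) -has_filter; apply/hasPn => k /H; lia.
split; last by move=> s r h u vs E; have [] := det _ _ _ _ vs E.
split=> //.
- by move=> s /run_hull[r [h [u [E _ _ _ _]]]]; exists r, h, u.
- exists (800 * 3), 2 => s r h u vs n2 E; have [_ _ _ H] := det _ _ _ _ vs E.
  by have := log_bound n2; lia.
- exists 3, (4950 * 3 ^ 3), 2 => s r h u vs n2 E; have [_ _ H _] := det _ _ _ _ vs E.
  apply: leq_trans H _; rewrite -mulnA -expnMn leq_mul2l leq_exp2r //.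
  exact: log_bound.
- exists (800 * 3), 2 => s r h u vs n2 E; have [_ _ _ H] := det _ _ _ _ vs E.
  by rewrite (alloc _ _ _ _ vs E) /= addn0; have := log_bound n2; lia.
Qed.
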